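(* Let $S_1$ and $S_2$ be strings over a constant-size alphabet, and let $d$ be the edit distance between $S_1$ and $S_2$ (the minimum number of single-character insertions, deletions and substitutions needed to change $S_1$ into $S_2$). Given a data structure supporting select queries on $S_1$, one can store $O(d)$ additional words and support any select query on $S_2$ using $O(\log \log (|S_1| + |S_2|))$ time in addition to the time of one select query on $S_1$.
   Context: Model: word-RAM with words of $\Omega(\log(|S_1|+|S_2|))$ bits; the alphabet size is constant. For a string $S$, a character $a$ and a positive integer $j$, the query $S.\mathrm{select}_a(j)$ returns the position of the $j$th leftmost occurrence of $a$ in $S$. Similarly $S.\mathrm{rank}_a(i)$ returns the number of occurrences of $a$ in the prefix of $S$ of length $i$. *)

(* Defs.v *)
From mathcomp Require Import all_boot.
Set Implicit Arguments. Unset Strict Implicit. Unset Printing Implicit Defensive.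

(* S.select_a(j): the position (1-based, i.e. length of the shortest prefix
   containing j occurrences of a) of the j-th leftmost occurrence of a in S;
   0 if there is no such occurrence (j = 0 or j > count). *)
Definition rank_ (T : eqType) (S : seq T) (a : T) (i : nat) : nat :=
  count_mem a (take i S).

Definition select_ (T : eqType) (S : seq T) (a : T) (j : nat) : nat :=
  if (0 < j) && (j <= count_mem a S) then
    find (fun i => rank_ S a i == j) (iota 0 (size S).+1)
  else 0.

Definition edit1 (T : Type) (s t : seq T) : Prop :=
  exists (u v : seq T) (x y : T),
    (s = u ++ x :: v /\ t = u ++ v) \/
    (s = u ++ v /\ t = u ++ x :: v) \/
    (s = u ++ x :: v /\ t = u ++ y :: v).

Fixpoint edits (T : Type) (n : nat) (s t : seq T) : Prop :=
  match n with
  | 0 => s = t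
  | n'.+1 => exists u, edit1 s u /\ edits n' u t
  end.

Definition edit_distance (T : Type) (s t : seq T) (d : nat) : Prop :=
  edits d s t /\ forall m, edits m s t -> d <= m.

Inductive binop := OAdd | OSub | OMul | ODiv | OMod | OAnd | OOr | OXor
                 | OShl | OShr | OLt | OEq.

Inductive instr :=
  | IConst (r : nat) (c : nat)
  | IBin (o : binop) (r r1 r2 : nat)
  | ILoad (r ra : nat)                      (* r := M[ra] (0 if out of range) *)
  | ISelect (r rc rj : nat)
  | IJz (r target : nat)
  | IJmp (target : nat)
  | IHalt (r : nat).

Definition program := seq instr.

Definition wmod (w x : nat) : nat := x %% 2 ^ w.

Definition eval_binop (w : nat) (o : binop) (x y : nat) : nat :=
  wmod w (match o with
          | OAdd => x + y
          | OSub => x + 2 ^ w - y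
          | OMul => x * y
          | ODiv => x %/ y
          | OMod => x %% y
          | OAnd => Nat.land x y
          | OOr => Nat.lor x y
          | OXor => Nat.lxor x y
          | OShl => Nat.shiftl x y
          | OShr => Nat.shiftr x y
          | OLt => (x < y : nat)
          | OEq => (x == y : nat)
          end).

Definition upd (f : nat -> nat) (r v : nat) : nat -> nat :=
  fun i => if i == r then v else f i.

(* A configuration: program counter, registers, number of select-oracle
   calls so far, number of other executed instructions so far. *)
Record config := Config { pc : nat; regs : nat -> nat; nsel : nat; nsteps : nat }.

(* [oracle c j] answers select query number j for the character of code c. *)
Fixpoint exec (P : program) (w : nat) (M : seq nat) (oracle : nat -> nat -> nat)
  (fuel : nat) (st : config) : option (nat * nat * nat) :=
  match fuel with
  | 0 => None
  | fuel'.+1 =>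
    let: Config p R s t := st in
    let go st' := exec P w M oracle fuel' st' in
    match nth (IJmp p) P p with  (* pc out of range: loops forever *)
    | IConst r c => go (Config p.+1 (upd R r (wmod w c)) s t.+1)
    | IBin o r r1 r2 => go (Config p.+1 (upd R r (eval_binop w o (R r1) (R r2))) s t.+1)
    | ILoad r ra => go (Config p.+1 (upd R r (wmod w (nth 0 M (R ra)))) s t.+1)
    | ISelect r rc rj => go (Config p.+1 (upd R r (wmod w (oracle (R rc) (R rj)))) s.+1 t)
    | IJz r tg => go (Config (if R r == 0 then tg else p.+1) R s t.+1)
    | IJmp tg => go (Config tg R s t.+1)
    | IHalt r => Some (R r, s, t.+1)
    end
  end.

Definition runs (P : program) (w : nat) (M : seq nat) (oracle : nat -> nat -> nat)
  (a j out ns nt : nat) : Prop :=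
  exists fuel, exec P w M oracle fuel
                 (Config 0 (upd (upd (fun _ => 0) 0 a) 1 j) 0 0) = Some (out, ns, nt).

(* The select oracle of S1, on character codes (enum_rank); 0 for invalid codes. *)
Definition select_oracle (T : finType) (S : seq T) : nat -> nat -> nat :=
  fun c j => match insub c : option 'I_#|T| with
             | Some i => select_ S (enum_val i) j
             | None => 0
             end.

Definition code (T : finType) (a : T) : nat := enum_rank a.

(* Main.v *)
Require Import Defs.
From mathcomp Require Import all_boot zify.
Set Implicit Arguments. Unset Strict Implicit. Unset Printing Implicit Defensive.

(* Each edit changes [j |-> S2.select_a(j)] by shifts of argument and value beyond one point, so
   this map is piecewise of the form [j |-> S1.select_a(j + al) + be] with O(d) pieces.  The piece
   containing [j] is found by a y-fast trie on the breakpoints: every h-th breakpoint, with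
   h ~ log(|S1| + |S2|), is put in a binary trie whose nodes are stored in a perfect hash table
   (multiply-shift hashing, two levels); a binary search on the height finds the lowest node above
   [j], and a second one runs inside a bucket of h breakpoints.

   Only 2^w words can be addressed with computed addresses.  When the O(d) words exceed this, S2
   is cut instead into blocks of g positions, g a large constant: a piece is a block, and its
   record packs the offsets of the occurrences of [a].  When w is bounded, S2 is stored verbatim
   and scanned; the characters whose codes are not words are relabelled by unused words, and
   [M] at the address [code a] holds the label of [a]. *)

(** * Select queries under edits *)

(** Shifts can be negative and words are unsigned, so the shifts are kept modulo [2 ^ w], where word
    addition wraps around. An inserted occurrence of [a] has no source in the first string; it is
    sent to argument 0, on which [select_] returns 0, so that the additive shift alone gives the
    answer. The keys have about log(|S1| + |S2|) bits whatever the word length, which makes the time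
    depend on the strings and not on [w]. Falling back on blocks is affordable because it happens
    only when the O(d) bound exceeds [2 ^ w]: then any structure that fits in the addressable words
    is within the bound. Pieces and blocks share one record format, and a [mode] word tells the
    program how to evaluate a record. Hashing needs no randomness at query time: good multipliers
    exist by averaging and are stored with the tables. *)

Section Select.
Variable T : eqType.
Implicit Types (S s t u xs ys : seq T) (a c : T).

Lemma select_mid xs ys a :
  select_ (xs ++ a :: ys) a (count_mem a xs).+1 = (size xs).+1.
Proof.
rewrite /select_ ifT; last by rewrite count_cat /= eqxx; lia.
set P := (fun i => _); set S := xs ++ _.
have P1 : P (size xs).+1.
  by rewrite /P /rank_ /S take_cat ltnNge leqnSn /= subSnn /= count_cat /= take0 eqxx /= addn1.
have P0 i : i < (size xs).+1 -> P i = false.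
  move=> lti; rewrite /P /rank_ /S takel_cat ?count_take_leq //.
  apply/negbTE; rewrite neq_ltn ltnS; apply/orP; left.
  by rewrite -[X in _ <= count_mem a X](cat_take_drop i xs) count_cat leq_addr.
have -> : (size S).+1 = (size xs).+1 + (size ys).+1 by rewrite size_cat /=; lia.
rewrite iotaD find_cat size_iota ifF; last first.
  apply/negbTE/hasPn => i; rewrite mem_iota add0n => /andP[_ lti].
  by rewrite P0.
by rewrite add0n /= P1 addn0.
Qed.

Lemma count_split S a j : 0 < j <= count_mem a S ->
  exists xs ys, S = xs ++ a :: ys /\ count_mem a xs = j.-1.
Proof.
elim: S j => [|x S IH] j /=; first by lia.
have [->|nxa] := eqVneq x a.
  case: j => [|[|j]] //= lej; first by exists [::], S.
  have [xs [ys [-> cnt]]] := IH j.+1 ltac:(lia).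
  by exists (a :: xs), ys; rewrite /= eqxx cnt.
rewrite add0n => /IH[xs [ys [-> cnt]]].
by exists (x :: xs), ys; rewrite /= (negbTE nxa).
Qed.

Lemma select_split S a j : 0 < j <= count_mem a S ->
  exists xs ys, [/\ S = xs ++ a :: ys, count_mem a xs = j.-1
                  & select_ S a j = (size xs).+1].
Proof.
move=> vj; have [xs [ys [defS cnt]]] := count_split vj.
exists xs, ys; split => //; rewrite defS -(select_mid xs ys a) cnt.
by case: j vj {cnt}.
Qed.

Lemma select_catl xs ys a j : 0 < j <= count_mem a xs ->
  select_ (xs ++ ys) a j = select_ xs a j.
Proof.
move=> vj; have [x1 [x2 [defx cnt ->]]] := select_split vj.
have -> : j = (count_mem a x1).+1 by lia.
by rewrite defx -catA cat_cons select_mid.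
Qed.

Lemma select_catr xs ys a j : 0 < j <= count_mem a ys ->
  select_ (xs ++ ys) a (count_mem a xs + j) = size xs + select_ ys a j.
Proof.
move=> vj; have [y1 [y2 [defy cnt ->]]] := select_split vj.
have -> : count_mem a xs + j = (count_mem a (xs ++ y1)).+1.
  by rewrite count_cat; lia.
by rewrite defy catA select_mid size_cat addnS.
Qed.

(** The Galois connection between select and rank; it turns comparisons of positions into
    comparisons of counts, as needed for blocks. *)
Lemma ltn_select S a j p : 0 < j <= count_mem a S ->
  (p < select_ S a j) = (count_mem a (take p S) < j).
Proof.
move=> vj; have [xs [ys [-> cnt ->]]] := select_split vj.
rewrite ltnS take_cat; case: (ltngtP p (size xs)) => [ltp|ltp|->].
- have : count_mem a (take p xs) <= count_mem a xs.
    by rewrite -{2}(cat_take_drop p xs) count_cat leq_addr.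
  by lia.
- have -> : p - size xs = (p - size xs).-1.+1 by lia.
  by rewrite count_cat /= eqxx; lia.
by rewrite subnn take0 cats0; lia.
Qed.

(** One equation serves both edits: insertion of [c] reads it from right to left, deletion from left
    to right. *)
Lemma select_insr xs ys a c j :
  count_mem a xs < j <= count_mem a (xs ++ ys) ->
  select_ (xs ++ c :: ys) a (j + (c == a)) = (select_ (xs ++ ys) a j).+1.
Proof.
rewrite count_cat => vj; set k := count_mem a xs in vj *.
have [i -> vi] : exists2 i, j = k + i & 0 < i <= count_mem a ys by exists (j - k); lia.
rewrite select_catr // -addnA [i + _]addnC select_catr /=; last by lia.
rewrite -[c :: ys]cat1s -[(c == a : nat)](addn0 (c == a)) select_catr //.
by rewrite addnA addn1.
Qed.

Lemma select_bounds S a j : 0 < j <= count_mem a S -> 0 < select_ S a j <= size S.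
Proof.
move=> vj; have [xs [ys [-> _ ->]]] := select_split vj.
by rewrite size_cat /=; lia.
Qed.

Lemma count_takeD S a p q :
  count_mem a (take (p + q) S) <= count_mem a (take p S) + q.
Proof.
rewrite takeD count_cat leq_add2l; apply: leq_trans (count_size _ _) _.
by rewrite size_take; case: ifP; lia.
Qed.

Lemma leq_count_take S a p q :
  p <= q -> count_mem a (take p S) <= count_mem a (take q S).
Proof. by move=> /subnKC <-; rewrite takeD count_cat leq_addr. Qed.

End Select.

(* [select_ t] follows [select_ S] up to the shifts [al] (of the argument) and [be] (of the
   result), which are constant away from the breakpoints [bs]. *)
Definition piecewise (T : eqType) (N : nat) (S : seq T) (a : T)
    (bs : seq nat) (al be : nat -> nat) (t : seq T) : Prop :=
  (forall j, j.+1 \notin bs -> al j.+1 = al j /\ be j.+1 = be j) /\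
  forall j, 0 < j <= count_mem a t ->
    exists i, [/\ i <= count_mem a S, i = j + al j %[mod N]
                & select_ t a j = select_ S a i + be j %[mod N]].

Section Piecewise.
Variables (T : eqType) (N : nat).
Hypothesis N_gt0 : 0 < N.
Implicit Types (S xs ys t u : seq T) (a c : T) (bs : seq nat) (al be : nat -> nat).

Lemma piecewise_refl S a : piecewise N S a [::] (fun=> 0) (fun=> 0) S.
Proof.
split=> // j /andP[j0 jle]; exists j.
by rewrite !addn0.
Qed.

(** Occurrences inside [xs] keep their number; later ones move by [e] in number and by one in
    position. An inserted occurrence of [a] is a piece of its own, whence the two breakpoints [k.+1]
    and [k.+2]. *)
Lemma piecewise_ins S a xs ys c bs al be :
  piecewise N S a bs al be (xs ++ ys) ->
  exists bs' al' be', size bs' <= size bs + 2 /\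
    piecewise N S a bs' al' be' (xs ++ c :: ys).
Proof.
move=> [bsP repP]; set k := count_mem a xs; set e : nat := c == a.
have e1 : e <= 1 by rewrite /e; case: eqP.
exists (k.+1 :: k.+2 :: [seq (if b <= k then b else b + e) | b <- bs]).
(* Adding [N.-1] subtracts one modulo [N]. For the inserted occurrence, [k.+1 * N.-1] cancels
   [j = k.+1], so the argument is 0. *)
exists (fun j => if j <= k then al j else
         if (j == k.+1) && (e == 1) then k.+1 * N.-1 else al (j - e) + e * N.-1).
exists (fun j => if j <= k then be j else
         if (j == k.+1) && (e == 1) then (size xs).+1 else be (j - e) + 1).
split; first by rewrite /= size_map addn2.
split.
  move=> j; rewrite !inE !negb_or => /and3P[jk1 jk2 jbs].
  case: (leqP j.+1 k) => ltjk.
    rewrite (leqW ltjk : j <= k); apply: bsP.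
    by apply: contra jbs => jbs; apply/mapP; exists j.+1; rewrite ?ltjk.
  have ltkj : k.+1 < j by lia.
  have nj : j.+1 - e \notin bs.
    apply: contra jbs => jbs; apply/mapP; exists (j.+1 - e) => //.
    by rewrite ifF; lia.
  rewrite (_ : j <= k = false) 1?(_ : j == k.+1 = false) /=; try by lia.
  rewrite (_ : j.+1 == k.+1 = false) /=; last by lia.
  have dj : j.+1 - e = (j - e).+1 by lia.
  by rewrite dj in nj *; have [-> ->] := bsP _ nj.
move=> j; rewrite count_cat /= -/e -/k => vj.
case: (leqP j k) => ltjk.
  have [i [ile iE sE]] := repP j ltac:(rewrite count_cat -/k; lia).
  by exists i; split=> //; rewrite -sE !select_catl //; lia.
case: eqP => [jk1|njk] /=.
  have [e_eq1|/eqP e_neq1] := eqVneq e 1.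
    exists 0; split=> //.
      by rewrite jk1 -{1}(muln1 k.+1) -mulnDr add1n prednK // modnMl mod0n.
    have /eqP ca : c == a by move: e_eq1; rewrite /e; case: eqP.
    by rewrite ca jk1 /k select_mid /select_ ltnn.
  have e0 : e = 0 by lia.
  have [i [ile iE sE]] := repP j ltac:(rewrite count_cat -/k; lia).
  exists i; rewrite e0 subn0 mul0n addn0; split=> //.
  rewrite addnA -[RHS]modnDml -sE modnDml addn1 -(@select_insr _ _ _ a c) ?count_cat -/e -/k.
    by rewrite e0 addn0.
  by lia.
have [i [ile iE sE]] := repP (j - e) ltac:(rewrite count_cat -/k; lia).
exists i; split=> //.
  rewrite iE; have [e0|e1'] : e = 0 \/ e = 1 by lia.
    by rewrite e0 subn0 mul0n addn0.
  by rewrite e1' mul1n -[LHS]modnDr; congr (_ %% _); lia.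
rewrite addnA -[RHS]modnDml -sE modnDml addn1 -(@select_insr _ _ _ a c) ?count_cat -/e -/k.
  by rewrite subnK //; lia.
by lia.
Qed.

Lemma piecewise_del S a xs ys c bs al be :
  piecewise N S a bs al be (xs ++ c :: ys) ->
  exists bs' al' be', size bs' <= size bs + 2 /\
    piecewise N S a bs' al' be' (xs ++ ys).
Proof.
move=> [bsP repP]; set k := count_mem a xs; set e : nat := c == a.
have e1 : e <= 1 by rewrite /e; case: eqP.
exists (k.+1 :: [seq (if b <= k then b else b - e) | b <- bs]).
(* Beyond [k], occurrence [j] had number [j + e] before the deletion and stood one position further
   right. *)
exists (fun j => if j <= k then al j else al (j + e) + e).
exists (fun j => if j <= k then be j else be (j + e) + N.-1).
split; first by rewrite /= size_map; lia.
split.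
  move=> j; rewrite !inE !negb_or => /andP[jk1 jbs].
  case: (leqP j.+1 k) => ltjk.
    rewrite (leqW ltjk : j <= k); apply: bsP.
    by apply: contra jbs => jbs; apply/mapP; exists j.+1; rewrite ?ltjk.
  have nj : j.+1 + e \notin bs.
    apply: contra jbs => jbs; apply/mapP; exists (j.+1 + e) => //.
    by rewrite ifF; lia.
  rewrite (_ : j <= k = false); last by lia.
  by rewrite addSn in nj *; have [-> ->] := bsP _ nj.
move=> j; rewrite count_cat /= -/k => vj.
case: (leqP j k) => ltjk.
  have [i [ile iE sE]] := repP j ltac:(rewrite count_cat -/k; lia).
  by exists i; split=> //; rewrite -sE !select_catl //; lia.
have [i [ile iE sE]] := repP (j + e) ltac:(rewrite count_cat /= -/k -/e; lia).
exists i; split=> //; first by rewrite iE; congr (_ %% _); lia.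
rewrite addnA -[RHS]modnDml -sE modnDml select_insr ?count_cat -/k; last by lia.
by rewrite -[LHS]modnDr; congr (_ %% _); lia.
Qed.

End Piecewise.

(** The source stays fixed while the target varies, so the induction must peel off the last edit,
    whereas [edits] unfolds from the first. *)
Lemma edits_rcons (T : Type) n (s t : seq T) :
  edits n.+1 s t -> exists u, edits n s u /\ edit1 u t.
Proof.
elim: n s => [|n IH] s /=; first by case=> u [su <-]; exists s.
case=> u [su /IH[v [uv vt]]]; exists v; split=> //.
by exists u.
Qed.

Lemma edits_piecewise (T : eqType) N (S t : seq T) a d : 0 < N -> edits d S t ->
  exists bs al be, size bs <= 4 * d /\ piecewise N S a bs al be t.
Proof.
move=> N0; elim: d t => [|d IH] t.
  by move=> /= <-; do 3!eexists; split; last exact: piecewise_refl.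
case/edits_rcons=> u [/IH[bs [al [be [szb pw]]]]] [xs [ys [x [y]]]].
case=> [[eu ->]|[[eu ->]|[eu ->]]]; subst u.
- have [bs' [al' [be' [sz' pw']]]] := piecewise_del N0 pw.
  by exists bs', al', be'; split=> //; lia.
- have [bs' [al' [be' [sz' pw']]]] := piecewise_ins N0 x pw.
  by exists bs', al', be'; split=> //; lia.
(* A substitution is a deletion followed by an insertion, at most two breakpoints each: hence the
   factor 4. *)
have [bs' [al' [be' [sz' pw']]]] := piecewise_del N0 pw.
have [bs2 [al2 [be2 [sz2 pw2]]]] := piecewise_ins N0 y pw'.
by exists bs2, al2, be2; split=> //; lia.
Qed.

(** * Predecessor keys and the records attached to them *)

Definition is_pred (ks : seq nat) i j : Prop :=
  [/\ i < size ks, nth 0 ks i <= j & i.+1 < size ks -> j < nth 0 ks i.+1].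

Lemma is_pred_max ks i j b :
  sorted leq ks -> is_pred ks i j -> b \in ks -> b <= j -> b <= nth 0 ks i.
Proof.
move=> srt [ltis lej ltj] /(nthP 0)[l ltl <-] leb.
case: (leqP l i) => [leli|ltil].
  by apply: sorted_leq_nth => //; exact: leq_trans.
have lti : i.+1 < size ks by exact: leq_ltn_trans ltil ltl.
have : nth 0 ks i.+1 <= nth 0 ks l by apply: sorted_leq_nth => //; exact: leq_trans.
by move=> le1; have := leq_trans (ltj lti) (leq_trans le1 leb); rewrite ltnn.
Qed.

(** The key 0 gives every query a predecessor; breakpoints above [n] concern no valid query, and
    dropping them bounds the bit length of the keys. *)
Definition keys_of (bs : seq nat) n : seq nat :=
  sort leq (undup (0 :: [seq b <- bs | b <= n])).

Lemma mem_keys_of bs n b : (b \in keys_of bs n) = (b == 0) || ((b <= n) && (b \in bs)).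
Proof. by rewrite mem_sort mem_undup inE mem_filter. Qed.

Lemma keys_of_sorted bs n : sorted leq (keys_of bs n).
Proof. by apply: sort_sorted; exact: leq_total. Qed.

Lemma size_keys_of bs n : size (keys_of bs n) <= (size bs).+1.
Proof.
rewrite size_sort; apply: leq_trans (size_undup _) _.
by rewrite /= ltnS size_filter count_size.
Qed.

Lemma size_keys_of_gt0 bs n : 0 < size (keys_of bs n).
Proof.
have : 0 \in keys_of bs n by rewrite mem_keys_of.
by case: (keys_of bs n).
Qed.

Lemma nth0_keys_of bs n : nth 0 (keys_of bs n) 0 = 0.
Proof.
have : 0 \in keys_of bs n by rewrite mem_keys_of.
case/(nthP 0)=> i lti i0; apply/eqP; rewrite -leqn0 -[X in _ <= X]i0.
by apply: (sorted_leq_nth leq_trans leqnn 0 (keys_of_sorted bs n));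
  rewrite ?inE ?size_keys_of_gt0.
Qed.

Lemma keys_of_le bs n : all (fun k => k <= n) (keys_of bs n).
Proof. by apply/allP=> b; rewrite mem_keys_of => /orP[/eqP->|/andP[]]. Qed.

(** Mode 0 evaluates a pair of shifts. Otherwise [al] is the 1-based first position of a block, and
    [be] packs [kk]-bit offsets, of which number [j - key] is extracted. The reductions modulo [N]
    are those of the machine. *)
Definition answer (mode N kk : nat) (sel : nat -> nat) (j key al be : nat) : nat :=
  if mode == 0 then (sel ((al + j) %% N) + be) %% N
  else al + (be %/ 2 ^ (((j - key) * kk) %% N)) %% 2 ^ kk.

Definition pieces (T : eqType) (mode N kk : nat) (S : seq T) (a : T) (t : seq T)
    (ks : seq nat) (A B : nat -> nat) : Prop :=
  [/\ nth 0 ks 0 = 0, 0 < size ks, all (fun k => k <= size t) ks,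
      forall i, A i < N /\ B i < N &
      forall i j, 0 < j <= count_mem a t -> is_pred ks i j ->
        answer mode N kk (select_ S a) j (nth 0 ks i) (A i) (B i) = select_ t a j].

Lemma edits_pieces (T : eqType) N kk (S t : seq T) a d :
    size S < N -> size t < N -> edits d S t ->
  exists ks A B, size ks <= 4 * d + 1 /\ pieces 0 N kk S a t ks A B.
Proof.
move=> ltS ltt; have N0 : 0 < N by lia.
case/(edits_piecewise a N0) => bs [al [be [szb [bsP repP]]]].
pose ks := keys_of bs (size t).
exists ks, (fun i => al (nth 0 ks i) %% N), (fun i => be (nth 0 ks i) %% N).
split; first by have := size_keys_of bs (size t); rewrite -/ks; lia.
split; [exact: nth0_keys_of | exact: size_keys_of_gt0 | exact: keys_of_le | |].
  by move=> i; rewrite !ltn_pmod.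
move=> i j vj pj; have [i' [lei' iE sE]] := repP j vj.
have lejt : j <= size t by have /andP[_ /leq_trans->] := vj; rewrite ?count_size.
set k := nth 0 ks i.
have [eal ebe] : al k = al j /\ be k = be j.
  have lekj : k <= j by case: pj.
  (* Every breakpoint up to [j] is a key, hence at most the predecessor key [k]; so both shifts are
     constant from [k] to [j]. *)
  have nobs b : k < b <= j -> b \notin bs.
    move=> /andP[kb bj]; apply/negP=> bbs; suff: b <= k by lia.
    apply: (is_pred_max (keys_of_sorted _ _) pj) => //.
    by rewrite mem_keys_of bbs andbT (leq_trans bj) ?orbT.
  rewrite -(subnKC lekj) in nobs *; elim: (j - k) nobs => [|l IH] nobs.
    by rewrite addn0.
  have nob : (k + l).+1 \notin bs by apply: nobs; rewrite addnS ltnS leq_addr leqnn.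
  rewrite addnS; have [-> ->] := bsP (k + l) nob.
  by apply: IH => b /andP[kb bl]; apply: nobs; rewrite kb addnS (leq_trans bl).
(* Since [i' <= size S < N], the reduced argument is [i'] itself and not merely congruent to it. *)
rewrite /answer /= eal ebe modnDml [al j + j]addnC -iE [i' %% N]modn_small; last first.
  by apply: leq_ltn_trans lei' _; apply: leq_ltn_trans (count_size _ _) _.
by rewrite modnDmr -sE modn_small //; have := select_bounds vj; lia.
Qed.

(** The base-[X] numeral with digits [f 0], [f 1], ..., the least significant first. *)
Fixpoint pack (X : nat) (f : nat -> nat) (n : nat) : nat :=
  if n is n'.+1 then f 0 + X * pack X (f \o succn) n' else 0.

Lemma pack_lt X f n : (forall i, f i < X) -> pack X f n < X ^ n.
Proof.
move=> fX; elim: n f fX => [|n IH] f fX //=.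
have := IH (f \o succn) (fun i => fX i.+1); have := fX 0.
by rewrite expnS; nia.
Qed.

Lemma pack_nth X f n i : (forall i, f i < X) -> i < n ->
  (pack X f n %/ X ^ i) %% X = f i.
Proof.
move=> fX; have X0 : 0 < X by apply: leq_ltn_trans (fX 0).
elim: n f fX i => [|n IH] f fX [|i] //= lti.
  by rewrite divn1 addnC mulnC modnMDl modn_small.
rewrite expnS divnMA divnDr ?dvdn_mulr // (divn_small (fX 0)) add0n mulKn //.
by rewrite (IH (f \o succn)) // => l; exact: fX.
Qed.

(** A block of [g] positions has at most [g] occurrences of [a], and an offset takes [kk] bits, so
    [kk * g] bits describe the block. *)
Lemma block_pieces (T : eqType) N kk g (S t : seq T) a :
    0 < g <= 2 ^ kk -> 2 ^ (kk * g) <= N -> size t < N ->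
  exists ks A B, size ks <= size t %/ g + 2 /\ pieces 1 N kk S a t ks A B.
Proof.
move=> /andP[g0 gkk] ltgN ltt.
(* Number of the first occurrence of [a] after the first [b] blocks. Blocks without [a] share this
   key with the next block and are merged by [undup]. *)
pose kap b := (count_mem a (take (b * g) t)).+1.
pose ks := keys_of [seq kap b | b <- iota 0 (size t %/ g).+1] (size t).
pose blk j := (select_ t a j).-1 %/ g.
(* The added key 0, and a key [(count_mem a t).+1] from the end of [t], number no occurrence and get
   a dummy. *)
pose A i := let k := nth 0 ks i in if 0 < k <= count_mem a t then (blk k * g).+1 else 0.
pose off k i := (select_ t a (k + i)).-1 %% g.
have offlt k i : off k i < 2 ^ kk by apply: leq_trans gkk; rewrite ltn_mod.
exists ks, A, (fun i => pack (2 ^ kk) (off (nth 0 ks i)) g).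
split.
  by have := size_keys_of [seq kap b | b <- iota 0 (size t %/ g).+1] (size t);
     rewrite size_map size_iota addn2.
split; [exact: nth0_keys_of | exact: size_keys_of_gt0 | exact: keys_of_le | |].
  move=> i; split; last by apply: leq_trans ltgN; rewrite expnM pack_lt.
  rewrite /A /=; set k := nth 0 ks i; case: ifP => lek; last by lia.
  have /andP[s0 sle] := select_bounds lek.
  by have := leq_trunc_div (select_ t a k).-1 g; rewrite /blk; lia.
move=> i j vj pj; rewrite /answer /=.
have sj := select_bounds vj.
set b := blk j.
have lebj : b * g <= (select_ t a j).-1 by exact: leq_trunc_div.
have ltjb : (select_ t a j).-1 < b.+1 * g by exact: ltn_ceil.
have kapj : kap b <= j by rewrite /kap -ltn_select //; lia.
have jkap : j < kap b.+1.
  by rewrite /kap ltnS leqNgt -ltn_select // -leqNgt; lia.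
have lejt : j <= size t by have /andP[_ /leq_trans->] := vj; rewrite ?count_size.
(* [kap b] is a key up to [j], hence at most the predecessor. Conversely the predecessor is 0 or
   some [kap b'], and [b' > b] would give [kap b' >= kap b.+1 > j]. *)
have kE : nth 0 ks i = kap b.
  apply/eqP; rewrite eqn_leq; apply/andP; split; last first.
    apply: (is_pred_max (keys_of_sorted _ _) pj) => //.
    rewrite mem_keys_of (leq_trans kapj lejt) map_f ?orbT //.
    by rewrite mem_iota ltnS /=; apply: leq_div2r; lia.
  have [ltis lej _] := pj.
  have := mem_nth 0 ltis; rewrite mem_keys_of => /orP[/eqP -> //|/andP[_ /mapP[b' _ kb']]].
  rewrite kb' in lej *.
  case: (leqP b' b) => [leb|ltb].
    by rewrite ltnS leq_count_take // leq_mul2r leb orbT.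
  have : kap b.+1 <= kap b' by rewrite ltnS leq_count_take // leq_mul2r ltb orbT.
  by lia.
have vk : 0 < kap b <= count_mem a t by rewrite (leq_trans kapj) //; lia.
(* Occurrence [kap b] lies past the first [b] blocks and not after occurrence [j], which is in block
   [b]. *)
have blkk : blk (kap b) = b.
  have lek : b * g < select_ t a (kap b) by rewrite ltn_select.
  have lekj : select_ t a (kap b) <= select_ t a j.
    rewrite leqNgt ltn_select // -leqNgt; apply: leq_trans kapj _.
    by rewrite leqNgt -ltn_select // ltnn.
  apply/eqP; rewrite /blk eqn_leq; apply/andP; split.
    by rewrite -ltnS ltn_divLR //; lia.
  by rewrite leq_divRL //; lia.
have ltg : j - kap b < g.
  by have := count_takeD t a (b * g) g; move: jkap; rewrite /kap mulSnr; lia.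
have ltN : (j - kap b) * kk < N.
  apply: leq_trans ltgN; apply: leq_ltn_trans (ltn_expl _ (isT : 1 < 2)).
  by rewrite mulnC leq_mul2l (ltnW ltg) orbT.
rewrite /A kE vk blkk (modn_small ltN) [_ * kk]mulnC expnM pack_nth //.
rewrite /off subnKC // -/b.
by have := divn_eq (select_ t a j).-1 g; rewrite -/(blk j) -/b; lia.
Qed.

(** * Perfect hashing *)

Lemma subn1_inj m n : 0 < m -> 0 < n -> m - 1 = n - 1 -> m = n.
Proof. by lia. Qed.

Section Multiplier.
Variable w : nat.
Let N := 2 ^ w.

Lemma coprime_pow2_odd a : odd a -> coprime N a.
Proof. by move=> oa; rewrite /N; case: w => [|w']; rewrite ?coprime1n // coprime_pexpl // coprime2n. Qed.

(* Injection into [0, D): with g = gcd(N, z) and r = a z mod N, a positive multiple of g, the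
   multiplier a goes to (r - g) + a / (N / g). *)
Lemma card_small_multiples z D : 0 < z < N ->
  #|[set a : 'I_N | odd a && ((a * z) %% N < D)]| <= D.
Proof.
move=> vz; have N0 : 0 < N by rewrite expn_gt0.
set Bad := [set _ | _]; pose g := gcdn N z; pose q := N %/ g.
have g0 : 0 < g by rewrite gcdn_gt0 N0.
have Nqg : N = q * g by rewrite divnK // dvdn_gcdl.
have q0 : 0 < q by move: N0; rewrite Nqg muln_gt0 => /andP[].
pose phi (a : nat) := (a * z) %% N - g + a %/ q.
have gr a : g %| (a * z) %% N.
  by rewrite /dvdn modn_dvdm ?dvdn_gcdl // -/(dvdn _ _) dvdn_mull // dvdn_gcdr.
have r_gt0 a : odd a -> 0 < (a * z) %% N.
  move=> oa; rewrite lt0n; apply/negP; rewrite -/(dvdn N _) Gauss_dvdr ?coprime_pow2_odd //.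
  by move/dvdn_leq => /(_ _); lia.
(* An odd [a] is a unit modulo [N], so the residue is a nonzero multiple of [g]. With [a %/ q < g]
   this puts [phi a] below the residue, hence below [D]. *)
have r_ge a : odd a -> g <= (a * z) %% N.
  by move=> oa; apply: dvdn_leq; rewrite ?gr ?r_gt0.
have v_lt a : a < N -> a %/ q < g by move=> lta; rewrite ltn_divLR // mulnC -Nqg.
have phi_lt (a : 'I_N) : a \in Bad -> phi a < D.
  rewrite inE => /andP[oa ltD]; apply: leq_trans ltD.
  by rewrite /phi; have := v_lt a (ltn_ord a); have := r_ge a oa; lia.
have phiE a : odd a -> a < N -> phi a %/ g = (a * z) %% N %/ g - 1 /\ phi a %% g = a %/ q.
  move=> oa lta; rewrite /phi; have rge := r_ge a oa.
  have /dvdnP[u ru] := gr a; rewrite ru in rge *.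
  have u0 : 0 < u by move: rge; case: u {ru} => //; lia.
  have -> : u * g - g = (u - 1) * g by rewrite mulnBl mul1n.
  by rewrite divnMDl // modnMDl mulnK // divn_small ?modn_small ?v_lt ?addn0.
have main a b : odd a -> odd b -> a < N -> b < N -> a <= b -> phi a = phi b -> a = b.
  move=> oa ob lta ltb leab eqp.
  have [qa ma] := phiE a oa lta; have [qb mb] := phiE b ob ltb.
  rewrite eqp in qa ma.
  have eqr : (b * z) = (a * z) %[mod N].
    have ra := r_gt0 a oa; have rb := r_gt0 b ob.
    have ga := r_ge a oa; have gb := r_ge b ob.
    rewrite -(divnK (gr b)) -(divnK (gr a)); congr (_ * _).
    by apply: subn1_inj; rewrite ?divn_gt0 // -qa -qb.
  (* Equal residues give [N %| (b - a) * z]; dividing by [g] leaves [q], which is coprime to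
     [z %/ g]. *)
  have dq : q %| b - a.
    have : N %| b * z - a * z by rewrite -eqn_mod_dvd ?leq_mul2r ?leab ?orbT //; apply/eqP.
    rewrite -mulnBl -(divnK (dvdn_gcdr N z)) -/g mulnA Nqg dvdn_pmul2r // Gauss_dvdl //.
    by rewrite coprime_sym /coprime -(eqn_pmul2r g0) mul1n muln_gcdl -Nqg divnK ?dvdn_gcdr // gcdnC.
  rewrite (divn_eq a q) (divn_eq b q) -ma -mb; congr (_ + _); apply/eqP.
  by rewrite eq_sym eqn_mod_dvd.
rewrite cardE -(size_map (fun a : 'I_N => phi a)) -[D in _ <= D](size_iota 0).
apply: uniq_leq_size.
  rewrite map_inj_in_uniq ?enum_uniq // => a b; rewrite !mem_enum !inE => /andP[oa _] /andP[ob _] eqp.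
  apply: val_inj => /=; case: (leqP a b) => [le|/ltnW le].
    exact: (main a b).
  by symmetry; apply: main.
by move=> x /mapP[a]; rewrite mem_enum => aB ->; rewrite mem_iota /= add0n phi_lt.
Qed.

(** The top [l] bits of the low word of [a * x]. *)
Definition hash (l a x : nat) := ((a * x) %% N) %/ 2 ^ (w - l).

Lemma hash_lt l a x : l <= w -> hash l a x < 2 ^ l.
Proof. by move=> lw; rewrite /hash ltn_divLR ?expn_gt0 // -expnD subnKC // ltn_mod expn_gt0. Qed.

(** Two residues in the same interval of length [D] differ by less than [D]; according to the sign,
    the difference is the residue for [x - y] or for its negative. *)
Lemma modn_sub_cases a x y D : y <= x < N -> 0 < D ->
  ((a * x) %% N) %/ D = ((a * y) %% N) %/ D ->
  (a * (x - y)) %% N < D \/ (a * (N - (x - y))) %% N < D.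
Proof.
move=> vxy D0 eqd; have N0 : 0 < N by rewrite expn_gt0.
set p := (a * x) %% N in eqd; set q := (a * y) %% N in eqd.
have ltp : p < N by rewrite ltn_mod.
have ltq : q < N by rewrite ltn_mod.
have dp := divn_eq p D; have dq := divn_eq q D.
have mp : p %% D < D by rewrite ltn_mod.
have mq : q %% D < D by rewrite ltn_mod.
case: (leqP q p) => [leqp|ltpq]; [left|right].
  have -> : (a * (x - y)) %% N = p - q; last by lia.
  rewrite -[RHS](@modn_small _ N); last by lia.
  apply/eqP; rewrite -(eqn_modDr (a * y)) -mulnDr subnK; last by case/andP: vxy.
  by rewrite -[X in X == _]/p -modnDmr -/q subnK // /p modn_mod.
have -> : (a * (N - (x - y))) %% N = q - p; last by lia.
rewrite -[RHS](@modn_small _ N); last by lia.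
apply/eqP; rewrite -(eqn_modDr (a * x)) -mulnDr.
have -> : N - (x - y) + x = N + y by clear -vxy; lia.
rewrite mulnDr modnMDl -[X in X == _]/q -modnDmr -/p subnK; last exact: ltnW.
by rewrite /q modn_mod.
Qed.

(** Union bound over the two signs of the difference, each counted by [card_small_multiples]. *)
Lemma card_collisions l x y : 0 < l <= w -> x < N -> y < N -> x != y ->
  #|[set a : 'I_N | odd a && (hash l a x == hash l a y)]| <= 2 * 2 ^ (w - l).
Proof.
move=> vl; have D0 : 0 < 2 ^ (w - l) by rewrite expn_gt0.
wlog: x y / y < x => [wl|ltyx] ltx lty nxy.
  case: (ltngtP x y) nxy => // lt _; last by apply: wl; rewrite // neq_ltn lt orbT.
  rewrite (_ : [set a : 'I_N | _] = [set a : 'I_N | odd a && (hash l a y == hash l a x)]).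
    by apply: wl => //; rewrite neq_ltn lt orbT.
  by apply/setP=> a; rewrite !inE eq_sym.
set A := [set a : 'I_N | odd a && ((a * (x - y)) %% N < 2 ^ (w - l))].
set B := [set a : 'I_N | odd a && ((a * (N - (x - y))) %% N < 2 ^ (w - l))].
have cA : #|A| <= 2 ^ (w - l) by apply: card_small_multiples; lia.
have cB : #|B| <= 2 ^ (w - l) by apply: card_small_multiples; lia.
apply: leq_trans (_ : #|A :|: B| <= _); last first.
  by rewrite mul2n -addnn; apply: leq_trans (leq_card_setU _ _) (leq_add cA cB).
apply: subset_leq_card; apply/subsetP=> a; rewrite !inE => /andP[-> /eqP eqh] /=.
by apply/orP; apply: (@modn_sub_cases _ x y) => //; rewrite (ltnW ltyx).
Qed.

Lemma sum_odd n : \sum_(a < n.*2 | odd a) 1 = n.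
Proof.
rewrite -(big_mkord odd (fun=> 1)); elim: n => [|n IH]; first by rewrite big_geq.
by rewrite doubleS big_mkcond !big_nat_recr //= -big_mkcond /= IH odd_double /= addn0 addn1.
Qed.

Definition collisions (l a : nat) (ks : seq nat) : nat :=
  \sum_(x <- ks) \sum_(y <- ks) ((x != y) && (hash l a x == hash l a y)).

(** Averaging over the [2 ^ w.-1] odd multipliers: an ordered pair of distinct keys collides for at
    most [2 * 2 ^ (w - l)] of them, a fraction [4 / 2 ^ l]. *)
Lemma exists_multiplier l ks : 0 < l <= w -> all (fun x => x < N) ks ->
  exists a, [/\ odd a, a < N & collisions l a ks * 2 ^ l <= 4 * size ks ^ 2].
Proof.
move=> vl ltks; have w0 : 0 < w by lia.
have N2 : N = (2 ^ w.-1).*2 by rewrite -muln2 -expnSr prednK.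
have sum_le : \sum_(a < N | odd a) collisions l a ks <= size ks ^ 2 * (2 * 2 ^ (w - l)).
  rewrite exchange_big /=.
  apply: leq_trans (_ : \sum_(x <- ks) (size ks * (2 * 2 ^ (w - l))) <= _); last first.
    by rewrite big_const_seq count_predT iter_addn_0 -mulnn; nia.
  rewrite big_seq [in leqRHS]big_seq; apply: leq_sum => x xks; rewrite exchange_big /=.
  apply: leq_trans (_ : \sum_(y <- ks) (2 * 2 ^ (w - l)) <= _); last first.
    by rewrite big_const_seq count_predT iter_addn_0; nia.
  rewrite big_seq [in leqRHS]big_seq; apply: leq_sum => y yks.
  have [->|nxy] := eqVneq x y; first by rewrite big1.
  apply: leq_trans (card_collisions vl (allP ltks x xks) (allP ltks y yks) nxy).
  rewrite -sum1_card big_mkcond [leqRHS]big_mkcond; apply: leq_sum => a _.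
  by rewrite inE /=; case: (odd a) => //=; case: (_ == _).
case: (boolP [exists a : 'I_N, odd a && (collisions l a ks * 2 ^ l <= 4 * size ks ^ 2)]).
  by case/existsP=> a /andP[oa le]; exists a; rewrite ltn_ord.
move/existsPn => H.
have : \sum_(a < N | odd a) (4 * size ks ^ 2).+1 <= \sum_(a < N | odd a) collisions l a ks * 2 ^ l.
  by apply: leq_sum => a oa; have := H a; rewrite oa /= -ltnNge.
have -> : \sum_(a < N | odd a) (4 * size ks ^ 2).+1 = (4 * size ks ^ 2).+1 * 2 ^ w.-1.
  rewrite -[X in _ = _ * X]sum_odd -N2 big_distrr /=.
  by apply: eq_bigr => a _; rewrite muln1.
rewrite -big_distrl /= => le1.
have := leq_trans le1 (leq_mul sum_le (leqnn (2 ^ l))).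
rewrite -!mulnA -expnD subnK; last by lia.
rewrite -/N N2 -muln2.
have : 0 < 2 ^ w.-1 by rewrite expn_gt0.
set n2 := size ks ^ 2; set W := 2 ^ w.-1.
by nia.
Qed.

End Multiplier.

(** * Two-level hash tables laid out in memory *)

Definition segment (M : seq nat) (b : nat) (s : seq nat) : Prop :=
  forall i, i < size s -> nth 0 M (b + i) = nth 0 s i.

Lemma segment_cat M b s1 s2 :
  segment M b (s1 ++ s2) <-> segment M b s1 /\ segment M (b + size s1) s2.
Proof.
split=> [H|[H1 H2] i].
  split=> i lti; first by rewrite H ?size_cat ?nth_cat ?lti // ltn_addr.
  by rewrite -addnA H ?size_cat ?ltn_add2l // nth_cat ltnNge leq_addr addKn.
rewrite size_cat nth_cat; case: (ltnP i (size s1)) => [lt _|le lti]; first exact: H1.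
by rewrite -[in LHS](subnKC le) addnA H2 // ltn_subLR.
Qed.

Section Dictionary.
Variables (w : nat) (v0 v1 : nat -> nat).
Let N := 2 ^ w.
Hypotheses (v0_lt : forall x, v0 x < N) (v1_lt : forall x, v1 x < N).

(** Membership is tested by comparing the first cell with [x]. An empty cell holds 0, so absence is
    only claimed to be visible for positive [x]. *)
Definition holds_entry (M : seq nat) (F : seq nat) (p x : nat) : Prop :=
  (x \in F -> [/\ nth 0 M p = x, nth 0 M p.+1 = v0 x & nth 0 M p.+2 = v1 x]) /\
  (x \notin F -> 0 < x -> nth 0 M p <> x).

(** With more than [4 * size F ^ 2] cells the averaging bound drops below one collision, so some
    multiplier is injective on [F]. *)
Lemma bucket_table (F : seq nat) : uniq F -> all (fun x => x < N) F -> 0 < w ->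
    8 * size F ^ 2 + 2 <= N ->
  exists a l tab, [/\ a < N, 0 < l <= w, 2 ^ l <= 8 * size F ^ 2 + 2,
    size tab = 3 * 2 ^ l /\ all (fun x => x < N) tab &
    forall x, holds_entry tab F (hash w l a x * 3) x].
Proof.
move=> uF ltF w0 leN; set n := 4 * size F ^ 2.
pose l := (trunc_log 2 n).+1.
have ltn : n < 2 ^ l by apply: trunc_log_ltn.
have len : 2 ^ l <= 8 * size F ^ 2 + 2.
  rewrite /l expnS; case: (posnP n) => [->|n0]; first by rewrite trunc_log0; lia.
  by have := trunc_logP (isT : 1 < 2) n0; rewrite /n; lia.
have lw : 0 < l <= w by rewrite /= -(leq_exp2l (m := 2)) //; exact: leq_trans len leN.
have [a [_ lta coll]] := exists_multiplier lw ltF.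
have inj : {in F &, injective (hash w l a)}.
  have : collisions w l a F = 0.
    apply/eqP; rewrite -leqn0 -ltnS -(ltn_pmul2r (m := 2 ^ l)) ?expn_gt0 // mul1n.
    exact: leq_ltn_trans coll ltn.
  move/eqP; rewrite sum_nat_seq_eq0 => /allP c0 x y xF yF eqh; apply/eqP.
  have := c0 x xF; rewrite /= sum_nat_seq_eq0 => /allP/(_ y yF) /=.
  by rewrite eqh eqxx andbT eqb0 negbK.
(* If nothing hashes to [i], [find] returns [size F] and the default 0 marks the cell as empty. *)
pose key i := nth 0 F (find (fun x => hash w l a x == i) F).
pose ent p := let x := key (p %/ 3) in if p %% 3 == 0 then x else if p %% 3 == 1 then v0 x else v1 x.
have key_cases i : key i \in F \/ key i = 0.
  rewrite /key; case: (ltnP (find (fun x => hash w l a x == i) F) (size F)) => lt.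
    by left; apply: mem_nth.
  by right; rewrite nth_default.
exists a, l, (mkseq ent (3 * 2 ^ l)); split=> //.
  split; first by rewrite size_mkseq.
  apply/allP=> _ /mapP[p _ ->]; rewrite /ent /=; case: ifP => _; last by case: ifP.
  by case: (key_cases (p %/ 3)) => [/(allP ltF)|->] //; rewrite expn_gt0.
move=> x; set h := hash w l a x.
have lth : h < 2 ^ l by rewrite hash_lt //; case/andP: lw.
have e0 : nth 0 (mkseq ent (3 * 2 ^ l)) (h * 3) = key h.
  by rewrite nth_mkseq /ent ?mulnK ?modnMl //= mulnC ltn_pmul2l.
have e1 : nth 0 (mkseq ent (3 * 2 ^ l)) (h * 3).+1 = v0 (key h).
  by rewrite nth_mkseq ?/ent -?[(h * 3).+1]addn1 ?divnMDl ?modnMDl //=; rewrite ?addn0 //; clear -lth; lia.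
have e2 : nth 0 (mkseq ent (3 * 2 ^ l)) (h * 3).+2 = v1 (key h).
  by rewrite nth_mkseq ?/ent -?[(h * 3).+2]addn2 ?divnMDl ?modnMDl //=; rewrite ?addn0 //; clear -lth; lia.
rewrite /holds_entry e0 e1 e2; split=> [xF|xF x0].
  suff -> : key h = x by [].
  have hasx : has (fun y => hash w l a y == h) F by apply/hasP; exists x; rewrite /h /=.
  apply: inj => //; first by rewrite mem_nth // -has_find.
  by apply/eqP; have := nth_find 0 hasx.
by case: (key_cases h) => [kF|->] kx; [move: xF; rewrite -kx kF | lia].
Qed.

(** Each bucket gets three header words: multiplier, divisor [2 ^ (w - l)] and absolute address of
    its table. The bound on [s + 2] keeps computed addresses from wrapping. *)
Lemma second_level (F : nat -> seq nat) n base : 0 < w ->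
    (forall i, uniq (F i)) -> (forall i, all (fun x => x < N) (F i)) ->
    base + \sum_(i < n) 3 * (8 * size (F i) ^ 2 + 2) <= N ->
  exists hd L, [/\ size hd = 3 * n, size L <= \sum_(i < n) 3 * (8 * size (F i) ^ 2 + 2),
    all (fun x => x < N) hd, all (fun x => x < N) L &
    forall M, segment M base L -> forall i x, i < n -> x < N ->
      let s := (nth 0 hd (i * 3) * x) %% N %/ nth 0 hd (i * 3).+1 * 3 + nth 0 hd (i * 3).+2 in
      s + 2 < base + size L /\ holds_entry M (F i) s x].
Proof.
move=> w0 uF ltF; elim: n => [|n IH].
  by exists [::], [::]; split; rewrite ?big_ord0.
rewrite big_ord_recr /=; set Sn := \sum_(i < n) _ => leN.
have [|hd [L [szh szL lth ltL LP]]] := IH; first by lia.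
have [|a [l [tab [lta lw le [sztab lttab] tabP]]]] := bucket_table (uF n) (ltF n) w0; first by lia.
exists (hd ++ [:: a; 2 ^ (w - l); base + size L]), (L ++ tab); split.
- by rewrite size_cat szh /=; lia.
- by rewrite size_cat sztab; rewrite -/Sn in szL; lia.
- rewrite all_cat lth /= lta ltn_exp2l // andbT /=.
  have : 0 < 2 ^ l by rewrite expn_gt0.
  by rewrite -/Sn in szL; lia.
- by rewrite all_cat ltL.
move=> M; rewrite segment_cat => -[segL segT] i x; rewrite ltnS leq_eqVlt => /orP[/eqP->|lti] ltx.
  have e d : d < 3 -> nth 0 (hd ++ [:: a; 2 ^ (w - l); base + size L]) (n * 3 + d) =
             nth 0 [:: a; 2 ^ (w - l); base + size L] d.
    by move=> _; rewrite nth_cat szh mulnC ltnNge leq_addr /= addKn.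
  have e0 := e 0 isT; have e1 := e 1 isT; have e2 := e 2 isT.
  rewrite addn0 addn1 addn2 /= in e0 e1 e2; rewrite e0 e1 e2.
  have lth2 : hash w l a x < 2 ^ l by rewrite hash_lt //; case/andP: lw.
  rewrite -/(hash w l a x) size_cat sztab; split; first by lia.
  have eM d : d < 3 -> nth 0 M (hash w l a x * 3 + (base + size L) + d) = nth 0 tab (hash w l a x * 3 + d).
    by move=> ltd; rewrite -segT ?sztab; [congr nth; lia | lia].
  have [in1 in2] := tabP x; split=> [xF|xF x0].
    have [t0 t1 t2] := in1 xF.
    by split; [move: (eM 0 isT) | move: (eM 1 isT) | move: (eM 2 isT)];
       rewrite ?addn0 ?addn1 ?addn2 => ->.
  by have := eM 0 isT; rewrite !addn0 => ->; apply: in2.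
have e d : d < 3 -> nth 0 (hd ++ [:: a; 2 ^ (w - l); base + size L]) (i * 3 + d) =
             nth 0 hd (i * 3 + d).
  by move=> ltd; rewrite nth_cat szh ifT //; lia.
have e0 := e 0 isT; have e1 := e 1 isT; have e2 := e 2 isT.
rewrite !addn0 !addn1 !addn2 /= in e0 e1 e2; rewrite e0 e1 e2.
have [lt2 he] := LP M segL i x lti ltx; split=> //.
by rewrite size_cat; lia.
Qed.

Definition bucket_addr (a1 D1 base x : nat) : nat := (a1 * x) %% N %/ D1 * 3 + base.

Definition slot (M : seq nat) (a1 D1 base x : nat) : nat :=
  let b := bucket_addr a1 D1 base x in
  (nth 0 M b * x) %% N %/ nth 0 M b.+1 * 3 + nth 0 M b.+2.

(** Required of every word [x], since the search also probes absent nodes. *)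
Definition dict_ok (M : seq nat) (a1 D1 base : nat) (ks : seq nat) : Prop :=
  forall x, x < N ->
    [/\ bucket_addr a1 D1 base x + 2 < N, slot M a1 D1 base x + 2 < N &
        holds_entry M ks (slot M a1 D1 base x) x].

(** With [k] keys and between [k] and [2 * k] buckets there are at most [4 * k] collisions, so the
    squared bucket sizes sum to at most [5 * k]. Tables take [24 * 5 * k + 6 * 2 * k] words and
    headers [3 * 2 * k]: 138 words per key. *)
Lemma exists_dict (ks : seq nat) base : 0 < w -> 0 < size ks -> uniq ks -> all (fun x => x < N) ks ->
    base + 138 * size ks <= N ->
  exists a1 D1 L, [/\ a1 < N, D1 < N, size L <= 138 * size ks, all (fun x => x < N) L &
    forall M, segment M base L -> dict_ok M a1 D1 base ks].
Proof.
move=> w0 ks0 uks ltks leN; set k := size ks in ks0 leN *.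
pose l := (trunc_log 2 k).+1.
have ltkl : k < 2 ^ l by apply: trunc_log_ltn.
have lel : 2 ^ l <= 2 * k by rewrite /l expnS leq_mul2l trunc_logP.
have lw : 0 < l <= w.
  by rewrite /= -(leq_exp2l (m := 2)) // -/N; apply: leq_trans lel _; lia.
have [a [_ lta coll]] := exists_multiplier lw ltks.
have collk : collisions w l a ks <= 4 * k.
  rewrite -(leq_pmul2r ks0) -mulnA mulnn; apply: leq_trans coll.
  by rewrite leq_mul2l (ltnW ltkl) orbT.
pose F i := [seq x <- ks | hash w l a x == i].
(* Both sides count the ordered pairs with equal hashes; the summand [k] is the diagonal. *)
have sumF : \sum_(i < 2 ^ l) size (F i) ^ 2 = collisions w l a ks + k.
  have -> : \sum_(i < 2 ^ l) size (F i) ^ 2 =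
            \sum_(x <- ks) \sum_(y <- ks) (hash w l a x == hash w l a y : nat).
    have sq (i : nat) : size (F i) ^ 2 =
        \sum_(x <- ks) \sum_(y <- ks) (hash w l a x == i) * (hash w l a y == i).
      have -> : size (F i) = \sum_(x <- ks) (hash w l a x == i).
        by rewrite size_filter -sum1_count big_mkcond; apply: eq_bigr => x _; case: eqP.
      by rewrite -mulnn big_distrl; apply: eq_bigr => x _; rewrite big_distrr.
    rewrite (eq_bigr _ (fun (i : 'I_(2 ^ l)) _ => sq i)).
    rewrite exchange_big /=; apply: eq_bigr => x _.
    rewrite exchange_big /=; apply: eq_bigr => y _.
    have ltx : hash w l a x < 2 ^ l by apply: hash_lt; case/andP: lw.
    rewrite (bigD1 (Ordinal ltx)) //= eqxx big1 ?addn0 ?mul1n; last first.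
      move=> i; rewrite -val_eqE /= => ni.
      by rewrite [hash w l a x == _]eq_sym (negbTE ni).
    by rewrite eq_sym; case: eqP.
  have -> : k = \sum_(x <- ks) \sum_(y <- ks) (x == y : nat).
    rewrite /k -sum1_size big_seq [RHS]big_seq; apply: eq_bigr => x xks.
    have -> : \sum_(y <- ks) (x == y : nat) = count_mem x ks; last by rewrite count_uniq_mem ?xks.
    by rewrite -sum1_count [RHS]big_mkcond /=; apply: eq_bigr => y _; rewrite eq_sym; case: eqP.
  rewrite -big_split /=; apply: eq_bigr => x _; rewrite -big_split /=; apply: eq_bigr => y _.
  by have [->|] := eqVneq x y; rewrite ?eqxx //= addn0.
have sz2 : \sum_(i < 2 ^ l) 3 * (8 * size (F i) ^ 2 + 2) = 24 * (collisions w l a ks + k) + 6 * 2 ^ l.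
  under eq_bigr => i _ do rewrite mulnDr mulnA.
  by rewrite big_split /= -big_distrr /= sumF sum_nat_const card_ord mulnC; lia.
have [//|i|i||hd [L [szh szL lth ltL LP]]] := @second_level F (2 ^ l) (base + 3 * 2 ^ l).
- exact: filter_uniq.
- by apply/allP=> x; rewrite mem_filter => /andP[_ /(allP ltks)].
- by rewrite sz2; lia.
exists a, (2 ^ (w - l)), (hd ++ L); split=> //.
- by rewrite ltn_exp2l; lia.
- by rewrite size_cat szh; rewrite sz2 in szL; lia.
- by rewrite all_cat lth.
move=> M; rewrite segment_cat szh => -[segh segL] x ltx.
have ltx2 : hash w l a x < 2 ^ l by apply: hash_lt; case/andP: lw.
have eM d : d < 3 -> nth 0 M (hash w l a x * 3 + base + d) = nth 0 hd (hash w l a x * 3 + d).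
  by move=> ltd; rewrite -segh ?szh; [congr nth; lia | lia].
have eM0 := eM 0 isT; have eM1 := eM 1 isT; have eM2 := eM 2 isT.
rewrite !addn0 !addn1 !addn2 in eM0 eM1 eM2.
have := LP M segL _ x ltx2 ltx; rewrite /= -eM0 -eM1 -eM2.
rewrite /slot /bucket_addr -/(hash w l a x) => -[lts he].
rewrite sz2 in szL; split.
- by clear -leN ltx2 lel ks0; lia.
- by apply: leq_trans lts _; clear -szL collk lel leN; lia.
have inF : (x \in F (hash w l a x)) = (x \in ks) by rewrite mem_filter eqxx.
by case: he; rewrite /holds_entry inF.
Qed.

End Dictionary.

(** * Predecessor structure *)

(** Heap numbering of the complete binary tree of height [h]: the ancestor of leaf [j] at height
    [k], the root being 1. *)
Definition node (h k j : nat) : nat := 2 ^ (h - k) + j %/ 2 ^ k.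

(** Leaves are left out, which keeps the node numbers below [2 ^ h]. *)
Definition trie (h : nat) (reps : seq nat) : seq nat :=
  undup [seq node h k r | r <- reps, k <- iota 1 h].

(** The leading bit of a heap number gives the depth; the other bits, shifted to leaf level, give
    the leftmost leaf below the node, [node_lo]. *)
Definition node_level (h x : nat) : nat := h - trunc_log 2 x.

Definition node_lo (h x : nat) : nat :=
  (x - 2 ^ trunc_log 2 x) * 2 ^ node_level h x.

(** Answer stored at [x] for a [j] in its left half; [node_val1] is the one for the right half. *)
Definition node_val0 (h : nat) (reps : seq nat) (x : nat) : nat :=
  find (fun r => node_lo h x < r) reps.

Definition node_val1 (h : nat) (reps : seq nat) (x : nat) : nat :=
  find (fun r => node_lo h x + 2 ^ node_level h x <= r) reps.

Lemma node_lt h k j : 0 < k <= h -> j < 2 ^ h -> 0 < node h k j < 2 ^ h.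
Proof.
move=> /andP[k0 kh] jh; rewrite addn_gt0 expn_gt0 /=.
have lt : j %/ 2 ^ k < 2 ^ (h - k) by rewrite ltn_divLR ?expn_gt0 // -expnD subnK.
rewrite -[X in _ < 2 ^ X](subnK kh); case: k k0 lt {kh} => // k _ lt.
apply: (@leq_trans (2 ^ (h - k.+1) * 2)); first by rewrite /node; lia.
by rewrite expnD leq_mul2l expnS leq_pmulr ?expn_gt0 ?orbT.
Qed.

Lemma node_logE h k j : k <= h -> j < 2 ^ h -> trunc_log 2 (node h k j) = h - k.
Proof.
move=> kh jh; apply: trunc_log_eq => //.
have lt : j %/ 2 ^ k < 2 ^ (h - k) by rewrite ltn_divLR ?expn_gt0 // -expnD subnK.
by rewrite /node leq_addr /= expnS mul2n -addnn ltn_add2l.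
Qed.

Lemma node_loE h k j : k <= h -> j < 2 ^ h -> node_lo h (node h k j) = j %/ 2 ^ k * 2 ^ k.
Proof. by move=> kh jh; rewrite /node_lo /node_level node_logE // /node addKn subKn. Qed.

Lemma node_levelE h k j : k <= h -> j < 2 ^ h -> node_level h (node h k j) = k.
Proof. by move=> kh jh; rewrite /node_level node_logE // subKn. Qed.

Lemma mem_trie h (reps : seq nat) k r : r \in reps -> 0 < k <= h -> node h k r \in trie h reps.
Proof.
move=> rr vk; rewrite mem_undup; apply/allpairsP; exists (r, k); split=> //=.
by rewrite mem_iota add1n ltnS.
Qed.

Lemma trie_root h (reps : seq nat) j : 0 < h -> 0 < size reps -> all (fun r => r < 2 ^ h) reps ->
  j < 2 ^ h -> node h h j \in trie h reps.
Proof.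
move=> h0; case: reps => // r reps _ /= /andP[lr _] lj.
have -> : node h h j = node h h r by rewrite /node !divn_small.
by apply: mem_trie; rewrite ?inE ?eqxx // h0 /=.
Qed.

Lemma trie_bounds h (reps : seq nat) : all (fun r => r < 2 ^ h) reps ->
  all (fun x => 0 < x < 2 ^ h) (trie h reps).
Proof.
move/allP=> lr; apply/allP=> x; rewrite mem_undup => /allpairsP[[r k] /= [rr]].
by rewrite mem_iota add1n ltnS => vk ->; apply: node_lt => //; exact: lr.
Qed.

Lemma size_trie h (reps : seq nat) : size (trie h reps) <= size reps * h.
Proof. by apply: leq_trans (size_undup _) _; rewrite size_allpairs size_iota. Qed.

(* At the lowest node [x] of the trie above [j], the child of [x] on the side of [j] is missing
   (or is the leaf [j]), so no representative separates [j] from the end of the interval of [x]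
   on that side. *)
Lemma trie_search h (reps : seq nat) j k : j < 2 ^ h -> k < h ->
    (k = 0 \/ node h k j \notin trie h reps) ->
  (if (j %/ 2 ^ k) %% 2 == 0 then node_val0 h reps (node h k.+1 j)
   else node_val1 h reps (node h k.+1 j)) = find (fun r => j < r) reps.
Proof.
move=> jh kh missing.
(* A representative below the child containing [j] would put that child in the trie; only a leaf, at
   [k = 0], escapes. *)
have sep r : r \in reps -> j %/ 2 ^ k * 2 ^ k <= r -> r < (j %/ 2 ^ k).+1 * 2 ^ k -> k = 0.
  move=> rr ler ltr; case: (posnP k) => // k0; case: missing => // /negP[].
  have -> : node h k j = node h k r.
    congr (_ + _); apply/eqP; rewrite eqn_leq.
    by rewrite leq_divRL ?expn_gt0 // ler /= -ltnS ltn_divLR ?expn_gt0.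
  by apply: mem_trie; rewrite ?k0 ?(ltnW kh).
have lo2 : j %/ 2 ^ k.+1 = j %/ 2 ^ k %/ 2 by rewrite expnSr divnMA.
rewrite /node_val0 /node_val1 node_loE // node_levelE // lo2 expnS mulnA.
have leP : j %/ 2 ^ k * 2 ^ k <= j by exact: leq_trunc_div.
have ltP : j < (j %/ 2 ^ k).+1 * 2 ^ k by apply: ltn_ceil; rewrite expn_gt0.
have k0E : k = 0 -> j %/ 2 ^ k * 2 ^ k = j by move=> ->; rewrite divn1 muln1.
have k0D : k = 0 -> 2 ^ k = 1 by move=> ->.
have PE := divn_eq (j %/ 2 ^ k) 2.
case: eqP => b0.
  rewrite b0 addn0 in PE; rewrite -PE; apply: eq_in_find => r rr.
  apply/idP/idP => [ltr|]; last exact: leq_ltn_trans.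
  rewrite ltnNge; apply/negP=> lerj.
  have kz := sep r rr (ltnW ltr) (leq_ltn_trans lerj ltP).
  by rewrite k0E // ltnNge lerj in ltr.
have b1 : (j %/ 2 ^ k) %% 2 = 1 by have := ltn_pmod (j %/ 2 ^ k) (isT : 0 < 2); case: (_ %% 2) b0 => [|[|]].
rewrite b1 in PE.
have -> : j %/ 2 ^ k %/ 2 * 2 * 2 ^ k + 2 * 2 ^ k = (j %/ 2 ^ k).+1 * 2 ^ k.
  by rewrite [in RHS]PE -mulnDl addn1 addn2.
apply: eq_in_find => r rr; apply/idP/idP => [/(leq_trans ltP)//|ltr].
rewrite leqNgt; apply/negP=> lthi.
have kz := sep r rr (leq_trans leP (ltnW ltr)) lthi.
by move: lthi; rewrite mulSn k0E // k0D // add1n ltnS leqNgt ltr.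
Qed.

(** Starting at key number [h] rather than 0 makes the index of the first representative above [j]
    equal to the bucket number of [j]. The list may be empty. *)
Definition rep_keys (h : nat) (ks : seq nat) : seq nat :=
  [seq nth 0 ks (i * h) | i <- iota 1 ((size ks).-1 %/ h)].

Lemma size_rep_keys h (ks : seq nat) : size (rep_keys h ks) = (size ks).-1 %/ h.
Proof. by rewrite size_map size_iota. Qed.

Lemma rep_keys_find h (ks : seq nat) j : 0 < h -> 0 < size ks -> nth 0 ks 0 <= j ->
  let q := find (fun r => j < r) (rep_keys h ks) in
  [/\ q * h < size ks, nth 0 ks (q * h) <= j &
      (q.+1 * h < size ks -> j < nth 0 ks (q.+1 * h))].
Proof.
move=> h0 ks0 le0 q.
have nthr i : i < (size ks).-1 %/ h -> nth 0 (rep_keys h ks) i = nth 0 ks (i.+1 * h).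
  by move=> lti; rewrite (nth_map 0) ?size_iota // nth_iota // add1n.
have leq : q <= (size ks).-1 %/ h by rewrite -size_rep_keys find_size.
split.
- have : q * h <= (size ks).-1 by rewrite -leq_divRL.
  by lia.
- case: {2}q (erefl q) => [->|q' qE]; first by rewrite mul0n.
  rewrite qE -nthr; last by move: leq; rewrite qE.
  have := @before_find _ 0 (fun r => j < r) (rep_keys h ks) q'.
  by rewrite -/q qE ltnSn => /(_ isT)/negbT; rewrite -leqNgt.
move=> lt; have ltq : q < (size ks).-1 %/ h by rewrite leq_divRL //; lia.
by rewrite -nthr //; apply: (@nth_find _ 0 (fun r => j < r)); rewrite has_find size_rep_keys.
Qed.

Section PredStructure.
Variable w : nat.
Let N := 2 ^ w.

Definition records_ok (M : seq nat) (rec : nat) (ks : seq nat) (A B : nat -> nat) : Prop :=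
  rec + 3 * size ks <= N /\
  forall i, i < size ks ->
    [/\ nth 0 M (i * 3 + rec) = nth 0 ks i, nth 0 M (i * 3 + rec).+1 = A i &
        nth 0 M (i * 3 + rec).+2 = B i].

Definition structure_ok (M : seq nat) (p mode h : nat) (ks : seq nat) (A B : nat -> nat) : Prop :=
  exists rec a1 D1 base1 : nat,
  let reps := rep_keys h ks in
  [/\ p + 8 <= N,
      segment M p [:: mode; size reps; h; size ks; rec; a1; D1; base1],
      records_ok M rec ks A B &
      0 < size reps -> dict_ok w (node_val0 h reps) (node_val1 h reps) M a1 D1 base1 (trie h reps)].

(** One representative per [h] keys and at most [h] trie nodes per representative leave fewer than
    [m] nodes. Header, records and dictionary take at most [8 + 3 * m + 138 * m.-1] words. *)
Lemma exists_structure base mode h (ks : seq nat) (A B : nat -> nat) :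
    0 < h <= w -> mode < N -> 0 < size ks -> all (fun k => k < 2 ^ h) ks ->
    (forall i, A i < N /\ B i < N) -> base + 150 * size ks <= N ->
  exists L, [/\ size L <= 150 * size ks, all (fun x => x < N) L &
    forall M, segment M base L -> structure_ok M base mode h ks A B].
Proof.
move=> /andP[h0 hw] modeN ks0 ltks ltAB leN.
have hN : 2 ^ h <= N by rewrite leq_exp2l.
have lthN : h < N by apply: leq_trans hN; exact: ltn_expl.
set m := size ks in ks0 leN *; set reps := rep_keys h ks; set R := size reps.
have RE : R = m.-1 %/ h by exact: size_rep_keys.
have Rh : R * h <= m.-1 by rewrite RE leq_trunc_div.
have Rm : R <= m.-1 by apply: leq_trans Rh; rewrite leq_pmulr.
have ltreps : all (fun r => r < 2 ^ h) reps.
  apply/allP=> _ /mapP[i _ ->]; case: (ltnP (i * h) (size ks)) => lt.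
    exact: (allP ltks _ (mem_nth _ lt)).
  by rewrite nth_default // expn_gt0.
have szt : size (trie h reps) <= m.-1 by apply: leq_trans (size_trie _ _) _.
have tb := trie_bounds ltreps.
pose recL := mkseq (fun i => if i %% 3 == 0 then nth 0 ks (i %/ 3)
                        else if i %% 3 == 1 then A (i %/ 3) else B (i %/ 3)) (m * 3).
have lrec : all (fun x => x < N) recL.
  apply/allP=> x /mapP[i]; rewrite mem_iota /= add0n => lti ->.
  have lti' : i %/ 3 < m by rewrite ltn_divLR.
  have [? ?] := ltAB (i %/ 3).
  case: ifP => _; last by case: ifP.
  exact: leq_trans (allP ltks _ (mem_nth _ lti')) hN.
have rec_ok M : segment M (base + 8) recL -> records_ok M (base + 8) ks A B.
  move=> seg; split=> [|i lti]; first by rewrite -/m; lia.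
  have e d : d < 3 -> nth 0 M (i * 3 + (base + 8) + d) = nth 0 recL (i * 3 + d).
    move=> ltd; rewrite -seg ?size_mkseq -/m; first by congr nth; lia.
    by move: lti; rewrite -/m; lia.
  have e' d : d < 3 -> nth 0 recL (i * 3 + d) = if d == 0 then nth 0 ks i else if d == 1 then A i else B i.
    move=> ltd; rewrite nth_mkseq; last by move: lti; rewrite -/m; lia.
    by rewrite modnMDl divnMDl // (modn_small ltd) (divn_small ltd) addn0.
  have e0 := e 0 isT; have e1 := e 1 isT; have e2 := e 2 isT.
  rewrite !e' // !addn0 !addn1 !addn2 /= in e0 e1 e2.
  by split.
have [a1 [D1 [base1 [L [hl szL lL LP]]]]] : exists a1 D1 base1 L,
    [/\ [/\ a1 < N, D1 < N & base1 < N], size L <= 138 * m.-1, all (fun x => x < N) L &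
     forall M, segment M (base + 8 + m * 3) L -> 0 < R ->
     dict_ok w (node_val0 h reps) (node_val1 h reps) M a1 D1 base1 (trie h reps)].
  case: (posnP R) => [R0|R0].
    by exists 0, 0, 0, [::]; rewrite expn_gt0.
  have t0 : 0 < size (trie h reps).
    have ltN : 0 < 2 ^ h by rewrite expn_gt0.
    by have := trie_root h0 R0 ltreps ltN; case: (trie h reps).
  have ltt : all (fun x => x < N) (trie h reps).
    by apply/allP=> x /(allP tb)/andP[_ /leq_trans->].
  have lv0 x : node_val0 h reps x < N by have := find_size (fun r => node_lo h x < r) reps; rewrite -/R /node_val0; lia.
  have lv1 x : node_val1 h reps x < N by have := find_size (fun r => node_lo h x + 2 ^ node_level h x <= r) reps; rewrite -/R /node_val1; lia.
  have [||a1 [D1 [L [la lD szL lL LP]]]] := @exists_dict w _ _ lv0 lv1 _ (base + 8 + m * 3) _ t0 (undup_uniq _) ltt.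
  - by lia.
  - by rewrite -/N; lia.
  exists a1, D1, (base + 8 + m * 3), L; split=> //.
  - by split=> //; lia.
  - by apply: leq_trans szL _; rewrite leq_mul2l szt orbT.
  by move=> M /LP.
exists ([:: mode; R; h; m; base + 8; a1; D1; base1] ++ recL ++ L); split.
- by rewrite !size_cat size_mkseq /=; lia.
- have [? ? ?] := hl.
  have lR : R < N by lia.
  have lm : m < N by lia.
  have lb : base + 8 < N by lia.
  rewrite !all_cat lrec lL /= modeN lthN lR lm lb /=.
  by apply/andP; split=> //; apply/and4P; split.
move=> M /segment_cat[segH] /segment_cat[segR segL].
rewrite size_mkseq in segL.
exists (base + 8), a1, D1, base1; split=> //.
- by rewrite -/N; lia.
- exact: rec_ok.
by move=> R0; apply: LP.
Qed.

End PredStructure.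

(** * The query program *)

(* Registers: 0 and 1 hold the query (a, j), register 3 is constantly 0, registers 10, 11, 12
   hold 1, 2, 3, and 20, ..., 27 the header of the structure of [a]. *)
Definition query_program (k0 kk : nat) : program :=
  [:: (*  0 *) IConst 2 (2 ^ k0); IJz 2 99;
      (*  2 *) IConst 10 1; IConst 11 2; IConst 12 3; ILoad 2 0;
               ILoad 20 2; IBin OAdd 2 2 10; ILoad 21 2; IBin OAdd 2 2 10;
               ILoad 22 2; IBin OAdd 2 2 10; ILoad 23 2; IBin OAdd 2 2 10;
               ILoad 24 2; IBin OAdd 2 2 10; ILoad 25 2; IBin OAdd 2 2 10;
               ILoad 26 2; IBin OAdd 2 2 10; ILoad 27 2;
               IConst 4 0; IJz 21 60; IConst 5 0; IBin OAdd 6 22 10;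
      (* 25: binary search for the lowest trie node above j *)
               IBin OSub 7 6 5; IBin OLt 8 10 7; IJz 8 55;
               IBin ODiv 7 7 11; IBin OAdd 7 7 5;
               IBin OSub 8 22 7; IBin OShl 8 10 8; IBin OShr 9 1 7; IBin OAdd 8 8 9;
               IBin OMul 9 25 8; IBin ODiv 9 9 26; IBin OMul 9 9 12; IBin OAdd 9 9 27;
               ILoad 13 9; IBin OAdd 9 9 10; ILoad 14 9; IBin OAdd 9 9 10; ILoad 15 9;
               IBin OMul 13 13 8; IBin ODiv 13 13 14; IBin OMul 13 13 12; IBin OAdd 13 13 15;
               ILoad 14 13; IBin OEq 14 14 8; IJz 14 53;
               IBin OAdd 6 7 3; IBin OAdd 16 13 3; IJmp 25;
      (* 53 *) IBin OAdd 5 7 3; IJmp 25;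
      (* 55 *) IBin OShr 7 1 5; IBin OMod 7 7 11; IBin OAdd 7 7 16; IBin OAdd 7 7 10; ILoad 4 7;
      (* 60: bucket number 4 *)
               IBin OMul 5 4 22; IBin OAdd 6 5 22; IBin OLt 7 23 6; IJz 7 65; IBin OAdd 6 23 3;
      (* 65: binary search in the bucket *)
               IBin OSub 7 6 5; IBin OLt 8 10 7; IJz 8 79;
               IBin ODiv 7 7 11; IBin OAdd 7 7 5;
               IBin OMul 8 7 12; IBin OAdd 8 8 24; ILoad 9 8; IBin OLt 9 1 9; IJz 9 77;
               IBin OAdd 6 7 3; IJmp 65;
      (* 77 *) IBin OAdd 5 7 3; IJmp 65;
      (* 79: evaluation of record number 5 *)
               IBin OMul 8 5 12; IBin OAdd 8 8 24; ILoad 7 8; IBin OAdd 8 8 10;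
               ILoad 9 8; IBin OAdd 8 8 10; ILoad 13 8; IJz 20 95;
      (* 87 *) IBin OSub 7 1 7; IConst 14 kk; IBin OMul 7 7 14; IBin OShr 13 13 7;
               IConst 14 (2 ^ kk); IBin OMod 13 13 14; IBin OAdd 9 9 13; IHalt 9;
      (* 95 *) IBin OAdd 9 9 1; ISelect 9 0 9; IBin OAdd 9 9 13; IHalt 9;
      (* 99: short words, linear scan *)
               IConst 10 1; IBin OAdd 4 0 3; IBin OEq 5 4 0; IJz 5 104; IJmp 105;
      (* 104 *) ILoad 4 0;
      (* 105 *) ILoad 8 6; IBin OEq 8 8 4; IBin OAdd 6 6 10; IBin OSub 1 1 8;
                IJz 1 111; IJmp 105; IHalt 6].

Lemma shiftl_expn x k : Nat.shiftl x k = x * 2 ^ k.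
Proof.
elim: k => [|k IH] /=; first by rewrite muln1.
by rewrite IH /Nat.double expnS plusE; lia.
Qed.

Lemma div2_half n : Nat.div2 n = n./2.
Proof.
have [//] : Nat.div2 n = n./2 /\ Nat.div2 n.+1 = n.+1./2.
by elim: n => [//|n [IH1 IH2]]; split=> //=; rewrite IH1.
Qed.

Lemma shiftr_divn x k : Nat.shiftr x k = x %/ 2 ^ k.
Proof.
elim: k => [|k IH] /=; first by rewrite divn1.
by rewrite div2_half -divn2 IH expnSr divnMA.
Qed.

Section Eval.
Variable w : nat.
Let N := 2 ^ w.

Lemma eval_add x y : x + y < N -> eval_binop w OAdd x y = x + y.
Proof. by move=> lt; rewrite /eval_binop /wmod modn_small. Qed.

Lemma eval_sub x y : y <= x < N -> eval_binop w OSub x y = x - y.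
Proof.
move=> /andP[yx xN]; rewrite /eval_binop /wmod addnC -addnBA // modnDl modn_small //.
exact: leq_ltn_trans (leq_subr _ _) xN.
Qed.

Lemma eval_mul x y : x * y < N -> eval_binop w OMul x y = x * y.
Proof. by move=> lt; rewrite /eval_binop /wmod modn_small. Qed.

Lemma eval_div x y : x < N -> eval_binop w ODiv x y = x %/ y.
Proof.
by move=> lt; rewrite /eval_binop /wmod modn_small //; exact: leq_ltn_trans (leq_div _ _) lt.
Qed.

Lemma eval_mod x y : x < N -> eval_binop w OMod x y = x %% y.
Proof.
by move=> lt; rewrite /eval_binop /wmod modn_small //; exact: leq_ltn_trans (leq_mod _ _) lt.
Qed.

Lemma eval_shr x y : x < N -> eval_binop w OShr x y = x %/ 2 ^ y.
Proof. by rewrite /eval_binop shiftr_divn; exact: eval_div. Qed.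

Lemma eval_shl1 k : k < w -> eval_binop w OShl 1 k = 2 ^ k.
Proof.
by move=> lt; rewrite /eval_binop /wmod shiftl_expn mul1n modn_small // ltn_exp2l.
Qed.

Lemma eval_lt x y : 0 < w -> eval_binop w OLt x y = (x < y).
Proof.
move=> w0; rewrite /eval_binop /wmod modn_small //.
by apply: leq_ltn_trans (ltn_expl w (isT : 1 < 2)); case: (x < y).
Qed.

Lemma eval_eq x y : 0 < w -> eval_binop w OEq x y = (x == y).
Proof.
move=> w0; rewrite /eval_binop /wmod modn_small //.
by apply: leq_ltn_trans (ltn_expl w (isT : 1 < 2)); case: (x == y).
Qed.

End Eval.

(** * Symbolic execution and running time of the query *)

Section Halts.
Variables (P : program) (w : nat) (M : seq nat) (oracle : nat -> nat -> nat) (out bound : nat).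

(** The bounds concern the final counters, so each rule below just prepends an instruction and the
    clock is compared with [bound] only at [IHalt]. *)
Definition halts (p : nat) (R : nat -> nat) (s t : nat) : Prop :=
  exists ns nt, (exists fuel, exec P w M oracle fuel (Config p R s t) = Some (out, ns, nt)) /\
    (ns <= 1 /\ nt <= bound).

Lemma halts_const p R s t r c v :
  nth (IJmp p) P p = IConst r c -> wmod w c = v ->
  halts p.+1 (upd R r v) s t.+1 -> halts p R s t.
Proof.
move=> Pp <- [ns [nt [[fuel ex] le]]]; exists ns, nt; split=> //.
by exists fuel.+1; rewrite /= Pp.
Qed.

Lemma halts_bin p R s t o r r1 r2 v :
  nth (IJmp p) P p = IBin o r r1 r2 -> eval_binop w o (R r1) (R r2) = v ->
  halts p.+1 (upd R r v) s t.+1 -> halts p R s t.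
Proof.
move=> Pp <- [ns [nt [[fuel ex] le]]]; exists ns, nt; split=> //.
by exists fuel.+1; rewrite /= Pp.
Qed.

Lemma halts_load p R s t r ra v :
  nth (IJmp p) P p = ILoad r ra -> wmod w (nth 0 M (R ra)) = v ->
  halts p.+1 (upd R r v) s t.+1 -> halts p R s t.
Proof.
move=> Pp <- [ns [nt [[fuel ex] le]]]; exists ns, nt; split=> //.
by exists fuel.+1; rewrite /= Pp.
Qed.

Lemma halts_select p R s t r rc rj v :
  nth (IJmp p) P p = ISelect r rc rj -> wmod w (oracle (R rc) (R rj)) = v ->
  halts p.+1 (upd R r v) s.+1 t -> halts p R s t.
Proof.
move=> Pp <- [ns [nt [[fuel ex] le]]]; exists ns, nt; split=> //.
by exists fuel.+1; rewrite /= Pp.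
Qed.

Lemma halts_jz p R s t r tg v :
  nth (IJmp p) P p = IJz r tg -> R r = v ->
  halts (if v == 0 then tg else p.+1) R s t.+1 -> halts p R s t.
Proof.
move=> Pp <- [ns [nt [[fuel ex] le]]]; exists ns, nt; split=> //.
by exists fuel.+1; rewrite /= Pp.
Qed.

Lemma halts_jmp p R s t tg :
  nth (IJmp p) P p = IJmp tg -> halts tg R s t.+1 -> halts p R s t.
Proof.
move=> Pp [ns [nt [[fuel ex] le]]]; exists ns, nt; split=> //.
by exists fuel.+1; rewrite /= Pp.
Qed.

Lemma halts_halt p R s t r :
  nth (IJmp p) P p = IHalt r -> R r = out -> s <= 1 -> t < bound -> halts p R s t.
Proof.
move=> Pp Rr s1 tb; exists s, t.+1; split=> //.
by exists 1; rewrite /= Pp Rr.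
Qed.

End Halts.

Ltac step_const v := apply: (@halts_const _ _ _ _ _ _ _ _ _ _ _ _ v); [reflexivity | | ].
Ltac step_bin v := apply: (@halts_bin _ _ _ _ _ _ _ _ _ _ _ _ _ _ v); [reflexivity | | ].
Ltac step_load v := apply: (@halts_load _ _ _ _ _ _ _ _ _ _ _ _ v); [reflexivity | | ].
Ltac step_select v := apply: (@halts_select _ _ _ _ _ _ _ _ _ _ _ _ _ v); [reflexivity | | ].
Ltac step_jz v := apply: (@halts_jz _ _ _ _ _ _ _ _ _ _ _ _ v); [reflexivity | | ].
Ltac step_jmp := apply: halts_jmp; [reflexivity | ].

Section Main.
Variables (k0 kk w : nat) (M : seq nat) (oracle : nat -> nat -> nat) (out bound : nat).
Variables (c j mode h rec a1 D1 base1 : nat) (ks : seq nat) (A B : nat -> nat).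
Let N := 2 ^ w.
Let m := size ks.
Let reps := rep_keys h ks.
Let v0 := node_val0 h reps.
Let v1 := node_val1 h reps.
Notation halts := (halts (query_program k0 kk) w M oracle out bound).

Hypotheses (k0_gt1 : 1 < k0) (kk_le : kk <= k0) (k0_lt : k0 < w).
Hypotheses (h_gt0 : 0 < h) (h_le : h <= w) (m_gt0 : 0 < m) (mh_lt : m + h < N) (j_lt : j < 2 ^ h).
Hypotheses (reps_lt : all (fun r => r < 2 ^ h) reps) (key0 : nth 0 ks 0 <= j).
Hypotheses (rec_ok : records_ok w M rec ks A B).
Hypotheses (ks_lt : all (fun k => k < N) ks) (AB_lt : forall i, A i < N /\ B i < N).
Hypothesis dict : 0 < size reps -> dict_ok w v0 v1 M a1 D1 base1 (trie h reps).
Hypothesis outE : forall i, is_pred ks i j ->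
  answer mode N kk (oracle c) j (nth 0 ks i) (A i) (B i) = out.
Hypothesis out_lt : out < N.
Hypothesis M_lt : forall i, nth 0 M i < N.

Record env (R : nat -> nat) : Prop := Env {
  e0 : R 0 = c; e1 : R 1 = j; e3 : R 3 = 0; e10 : R 10 = 1; e11 : R 11 = 2; e12 : R 12 = 3;
  e20 : R 20 = mode; e21 : R 21 = size reps; e22 : R 22 = h; e23 : R 23 = m; e24 : R 24 = rec;
  e25 : R 25 = a1; e26 : R 26 = D1; e27 : R 27 = base1 }.

Lemma env_upd R r v : r \in [:: 2; 4; 5; 6; 7; 8; 9; 13; 14; 15; 16] -> env R -> env (upd R r v).
Proof.
move=> rt [*]; split; rewrite /upd ifF //; apply/negP => /eqP re; by rewrite -re in rt.
Qed.

Ltac read eR := rewrite /upd /= ?(e0 eR) ?(e1 eR) ?(e3 eR) ?(e10 eR) ?(e11 eR) ?(e12 eR)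
  ?(e20 eR) ?(e21 eR) ?(e22 eR) ?(e23 eR) ?(e24 eR) ?(e25 eR) ?(e26 eR) ?(e27 eR).

Let w_gt0 : 0 < w. Proof. by lia. Qed.
Let hN : 2 ^ h <= N. Proof. by rewrite leq_exp2l. Qed.
Let jN : j < N. Proof. exact: leq_trans j_lt hN. Qed.
Let k0N : 2 ^ k0 < N. Proof. by rewrite ltn_exp2l. Qed.
Let N_gt3 : 3 < N.
Proof. by apply: ltn_trans k0N; rewrite -{1}(ltn_predK k0_gt1) expnS; have := ltn_expl k0.-1 (isT : 1 < 2); lia. Qed.
Let kkN : 2 ^ kk < N. Proof. by apply: leq_ltn_trans k0N; rewrite leq_exp2l. Qed.

Lemma halts_record R t i : env R -> R 5 = i -> is_pred ks i j -> t + 20 <= bound -> halts 79 R 0 t.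
Proof.
move=> eR Ri pi tb; have [lti lek _] := pi.
have [recN recE] := rec_ok; have [rk rA rB] := recE i lti.
have [AN BN] := AB_lt i; have kN := allP ks_lt _ (mem_nth 0 lti).
rewrite -/N -/m in recN; have ltim : i < m by [].
step_bin (i * 3); first by read eR; rewrite Ri eval_mul // -/N; lia.
step_bin (i * 3 + rec); first by read eR; rewrite eval_add // -/N; lia.
step_load (nth 0 ks i); first by rewrite /upd /= rk /wmod modn_small.
step_bin (i * 3 + rec).+1; first by read eR; rewrite eval_add ?addn1 // -/N; lia.
step_load (A i); first by rewrite /upd /= rA /wmod modn_small.
step_bin (i * 3 + rec).+2; first by read eR; rewrite eval_add ?addn1 // -/N; lia.
step_load (B i); first by rewrite /upd /= rB /wmod modn_small.
step_jz mode; first by read eR.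
have := outE pi; rewrite /answer; case: eqP => mode0 ans.
  step_bin ((A i + j) %% N); first by read eR.
  step_select (oracle c ((A i + j) %% N) %% N); first by read eR.
  step_bin out; first by rewrite -ans; read eR; rewrite /eval_binop /wmod modnDml.
  by apply: halts_halt; [reflexivity | | | lia].
step_bin (j - nth 0 ks i); first by read eR; rewrite eval_sub // lek.
step_const kk; first by rewrite /wmod modn_small //; apply: leq_trans (ltnW kkN); exact: ltn_expl.
step_bin (((j - nth 0 ks i) * kk) %% N); first by read eR.
step_bin (B i %/ 2 ^ (((j - nth 0 ks i) * kk) %% N)); first by read eR; rewrite eval_shr.
step_const (2 ^ kk); first by rewrite /wmod modn_small.
step_bin ((B i %/ 2 ^ (((j - nth 0 ks i) * kk) %% N)) %% 2 ^ kk).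
  by read eR; rewrite eval_mod //; apply: leq_ltn_trans (leq_div _ _) BN.
step_bin out; first by rewrite -ans; read eR; rewrite eval_add // ans.
by apply: halts_halt; [reflexivity | | | lia].
Qed.

(** Invariant: the predecessor of [j] has index in [[lo, hi)], where [hi = m] acts as an infinite
    key. A halving costs 12 instructions, within the 14 allowed. *)
Lemma halts_bucket_loop e R t lo hi : env R -> R 5 = lo -> R 6 = hi ->
    lo < hi <= m -> hi - lo <= 2 ^ e -> nth 0 ks lo <= j -> (hi < m -> j < nth 0 ks hi) ->
    t + 14 * e + 23 <= bound -> halts 65 R 0 t.
Proof.
elim: e R t lo hi => [|e IH] R t lo hi eR Rlo Rhi vlh le lelo lthi tb.
  step_bin (hi - lo); first by read eR; rewrite Rlo Rhi eval_sub // -/N; lia.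
  step_bin 0; first by read eR; rewrite eval_lt //; move: le; rewrite expn0; lia.
  step_jz 0; first by [].
  apply: (@halts_record _ _ lo); first by do !apply: env_upd => //.
  - by rewrite /upd /= Rlo.
  - by split=> //; [rewrite -/m; lia | have -> : lo.+1 = hi by move: le; rewrite expn0; lia].
  by lia.
step_bin (hi - lo); first by read eR; rewrite Rlo Rhi eval_sub // -/N; lia.
step_bin (nat_of_bool (1 < hi - lo)); first by read eR; rewrite eval_lt.
step_jz (nat_of_bool (1 < hi - lo)); first by [].
case: (ltnP 1 (hi - lo)) => d1 /=; last first.
  apply: (@halts_record _ _ lo); first by do !apply: env_upd => //.
  - by rewrite /upd /= Rlo.
  - by split=> //; [rewrite -/m; lia | have -> : lo.+1 = hi by lia].
  by lia.
have [recN recE] := rec_ok; rewrite -/N -/m in recN.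
set mid := (hi - lo) %/ 2 + lo.
have midE : lo < mid < hi by rewrite /mid; lia.
have lem1 : mid - lo <= 2 ^ e by rewrite /mid; move: le; rewrite expnS; lia.
have lem2 : hi - mid <= 2 ^ e by rewrite /mid; move: le; rewrite expnS; lia.
have ltm : mid < size ks by rewrite -/m; lia.
have [rk _ _] := recE mid ltm.
step_bin ((hi - lo) %/ 2); first by read eR; rewrite eval_div // -/N; lia.
step_bin mid; first by read eR; rewrite Rlo eval_add // -/mid -/N; lia.
step_bin (mid * 3); first by read eR; rewrite eval_mul // -/N; lia.
step_bin (mid * 3 + rec); first by read eR; rewrite eval_add // -/N; lia.
step_load (nth 0 ks mid).
  by rewrite /upd /= rk /wmod modn_small //; exact: (allP ks_lt _ (mem_nth _ ltm)).
step_bin (nat_of_bool (j < nth 0 ks mid)); first by read eR; rewrite eval_lt.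
step_jz (nat_of_bool (j < nth 0 ks mid)); first by [].
case: (ltnP j (nth 0 ks mid)) => ltk /=.
  step_bin mid; first by read eR; rewrite eval_add addn0 // -/N; lia.
  step_jmp; apply: (IH _ _ lo mid) => //; try lia; by do !apply: env_upd => //.
step_bin mid; first by read eR; rewrite eval_add addn0 // -/N; lia.
step_jmp; apply: (IH _ _ mid hi) => //; try lia; by do !apply: env_upd => //.
Qed.

Lemma halts_bucket e R t : env R -> R 4 = find (fun r => j < r) reps -> h <= 2 ^ e ->
  t + 14 * e + 30 <= bound -> halts 60 R 0 t.
Proof.
move=> eR R4 he tb; have [ltq leq ltj] := rep_keys_find h_gt0 m_gt0 key0.
rewrite -/reps in ltq leq ltj; set q := find _ _ in R4 ltq leq ltj.
have mN : m < N by lia.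
have ltqm : q * h < m by [].
step_bin (q * h); first by read eR; rewrite R4 eval_mul // -/N; lia.
step_bin (q * h + h); first by read eR; rewrite eval_add // -/N; lia.
step_bin (nat_of_bool (m < q * h + h)); first by read eR; rewrite eval_lt.
step_jz (nat_of_bool (m < q * h + h)); first by [].
case: (ltnP m (q * h + h)) => ltm /=.
  step_bin m; first by read eR; rewrite eval_add addn0.
  apply: (@halts_bucket_loop e _ _ (q * h) m) => //; try lia.
  by do !apply: env_upd => //.
apply: (@halts_bucket_loop e _ _ (q * h) (q * h + h)) => //; try lia.
  by do !apply: env_upd => //.
by rewrite -mulSnr.
Qed.

Lemma halts_child e R t lo : env R -> R 5 = lo -> lo < h -> 0 < size reps ->
    R 16 = slot w M a1 D1 base1 (node h lo.+1 j) -> node h lo.+1 j \in trie h reps ->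
    (lo = 0 \/ node h lo j \notin trie h reps) -> h <= 2 ^ e ->
    t + 14 * e + 35 <= bound -> halts 55 R 0 t.
Proof.
move=> eR R5 lth reps0 R16 inT ninT he tb.
have xN : node h lo.+1 j < N.
  by apply: leq_trans hN; have /andP[] := @node_lt h lo.+1 j lth j_lt.
have [_ sN [in1 _]] := dict reps0 xN; have [_ s1 s2] := in1 inT.
have find_lt : find (fun r => j < r) reps < N.
  by apply: leq_ltn_trans (find_size _ _) _; rewrite size_rep_keys; have := leq_div m.-1 h; rewrite -/m; lia.
have ts := trie_search j_lt lth ninT.
rewrite -/v0 -/v1 in ts; set sl := slot _ _ _ _ _ _ in R16 sN s1 s2.
rewrite -/N in sN.
have b2 : (j %/ 2 ^ lo) %% 2 < 2 by rewrite ltn_mod.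
set b := (j %/ 2 ^ lo) %% 2 in ts b2.
step_bin (j %/ 2 ^ lo); first by read eR; rewrite R5 eval_shr.
step_bin b; first by read eR; rewrite eval_mod //; apply: leq_ltn_trans (leq_div _ _) jN.
step_bin (b + sl); first by read eR; rewrite R16 eval_add // -/N; lia.
(* The bit [b] of [j] selects between the two values stored after the key of the slot. *)
step_bin (b + sl + 1); first by read eR; rewrite eval_add // -/N; lia.
step_load (find (fun r => j < r) reps).
  rewrite /upd /= -ts; case: eqP ts => b0 ts.
    by rewrite b0 add0n addn1 s1 /wmod modn_small // ts.
  have -> : b + sl + 1 = sl.+2 by lia.
  by rewrite s2 /wmod modn_small // ts.
apply: (@halts_bucket e) => //; try lia.
by do !apply: env_upd => //.
Qed.

(** Invariant: the ancestor of [j] at height [lo] is absent or a leaf, and the one at height [hi] is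
    present with its slot in register 16, unless [hi] is the sentinel [h.+1]. An iteration costs at
    most 28 instructions. *)
Lemma halts_trie_loop e e' R t lo hi : env R -> R 5 = lo -> R 6 = hi -> 0 < size reps ->
    lo < hi <= h.+1 -> hi - lo <= 2 ^ e ->
    (lo = 0 \/ node h lo j \notin trie h reps) ->
    (hi <= h -> node h hi j \in trie h reps /\ R 16 = slot w M a1 D1 base1 (node h hi j)) ->
    h <= 2 ^ e' -> t + 28 * e + 14 * e' + 40 <= bound -> halts 25 R 0 t.
Proof.
move=> + + + + + + + + he'.
have hN2 : h.+1 < N.
  have := ltn_expl w.-1 (isT : 1 < 2); have : 2 ^ w = 2 * 2 ^ w.-1 by rewrite -expnS prednK.
  by rewrite /N; lia.
have leave R' t' lo' hi' : env R' -> R' 5 = lo' -> 0 < size reps ->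
    lo' < hi' <= h.+1 -> hi' - lo' <= 1 ->
    (lo' = 0 \/ node h lo' j \notin trie h reps) ->
    (hi' <= h -> node h hi' j \in trie h reps /\ R' 16 = slot w M a1 D1 base1 (node h hi' j)) ->
    t' + 14 * e' + 35 <= bound -> halts 55 R' 0 t'.
  move=> eR R5 reps0 vlh d1 lo_out hi_in tb.
  have hiE : hi' = lo'.+1 by lia.
  have lth : lo' < h.
    (* The root is in the trie, so the search cannot end with [hi'] at the sentinel. *)
    rewrite ltnNge; apply/negP => leh; have loh : lo' = h by lia.
    case: lo_out; first by lia.
    by rewrite loh trie_root.
  have [in16 R16] := hi_in ltac:(by rewrite hiE); rewrite hiE in in16 R16.
  exact: (@halts_child e' _ _ lo').
elim: e R t lo hi => [|e IH] R t lo hi eR Rlo Rhi reps0 vlh le lo_out hi_in tb.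
  step_bin (hi - lo); first by read eR; rewrite Rlo Rhi eval_sub // -/N; lia.
  step_bin 0; first by read eR; rewrite eval_lt //; move: le; rewrite expn0; lia.
  step_jz 0; first by [].
  apply: (leave _ _ lo hi) => //; try lia; by do !apply: env_upd => //.
step_bin (hi - lo); first by read eR; rewrite Rlo Rhi eval_sub // -/N; lia.
step_bin (nat_of_bool (1 < hi - lo)); first by read eR; rewrite eval_lt.
step_jz (nat_of_bool (1 < hi - lo)); first by [].
case: (ltnP 1 (hi - lo)) => d1 /=; last first.
  apply: (leave _ _ lo hi) => //; try lia; by do !apply: env_upd => //.
set mid := (hi - lo) %/ 2 + lo.
have midE : lo < mid < hi by rewrite /mid; lia.
have lem1 : mid - lo <= 2 ^ e by rewrite /mid; move: le; rewrite expnS; lia.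
have lem2 : hi - mid <= 2 ^ e by rewrite /mid; move: le; rewrite expnS; lia.
have vmid : 0 < mid <= h by lia.
have /andP[x0 xh] := node_lt vmid j_lt.
set x := node h mid j in x0 xh; have xN : x < N by exact: leq_trans xh hN.
have [bN sN [inE ninE]] := dict reps0 xN; rewrite -/N in bN sN.
step_bin ((hi - lo) %/ 2); first by read eR; rewrite eval_div // -/N; lia.
step_bin mid; first by read eR; rewrite Rlo eval_add // -/mid -/N; lia.
step_bin (h - mid); first by read eR; rewrite eval_sub // -/N; lia.
step_bin (2 ^ (h - mid)); first by read eR; rewrite eval_shl1 //; lia.
step_bin (j %/ 2 ^ mid); first by read eR; rewrite eval_shr.
step_bin x; first by read eR; rewrite eval_add.
have ba_eq : bucket_addr w a1 D1 base1 x = (a1 * x) %% N %/ D1 * 3 + base1 by [].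
set ba := bucket_addr _ _ _ _ _ in bN ba_eq.
have sl_eq : slot w M a1 D1 base1 x =
  (nth 0 M ba * x) %% N %/ nth 0 M ba.+1 * 3 + nth 0 M ba.+2 by [].
set sl := slot _ _ _ _ _ _ in sN inE ninE sl_eq.
have modN y : y %% N < N by rewrite ltn_mod expn_gt0.
have modM i : wmod w (nth 0 M i) = nth 0 M i by rewrite /wmod modn_small.
step_bin ((a1 * x) %% N); first by read eR.
step_bin ((a1 * x) %% N %/ D1); first by read eR; rewrite eval_div.
step_bin ((a1 * x) %% N %/ D1 * 3); first by read eR; rewrite eval_mul // -/N; clear -bN ba_eq; lia.
step_bin ba; first by read eR; rewrite ba_eq eval_add // -/N; clear -bN ba_eq; lia.
step_load (nth 0 M ba); first exact: modM.
step_bin ba.+1; first by read eR; rewrite eval_add ?addn1 // -/N; clear -bN; lia.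
step_load (nth 0 M ba.+1); first exact: modM.
step_bin ba.+2; first by read eR; rewrite eval_add ?addn1 // -/N; clear -bN; lia.
step_load (nth 0 M ba.+2); first exact: modM.
step_bin ((nth 0 M ba * x) %% N); first by read eR.
step_bin ((nth 0 M ba * x) %% N %/ nth 0 M ba.+1); first by read eR; rewrite eval_div.
step_bin ((nth 0 M ba * x) %% N %/ nth 0 M ba.+1 * 3).
  by read eR; rewrite eval_mul // -/N; clear -sN sl_eq; lia.
step_bin sl; first by read eR; rewrite sl_eq eval_add // -/N; clear -sN sl_eq; lia.
step_load (nth 0 M sl); first exact: modM.
step_bin (nat_of_bool (nth 0 M sl == x)); first by read eR; rewrite eval_eq.
step_jz (nat_of_bool (nth 0 M sl == x)); first by [].
clear ba_eq sl_eq; have slN : sl < N by clear -sN; lia.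
clear sN bN; case: (nth 0 M sl =P x) => Mx /=.
  have xin : x \in trie h reps.
    by apply/negPn/negP => xo; exact: (ninE xo x0 Mx).
  step_bin mid; first by read eR; rewrite eval_add addn0 // -/N; lia.
  step_bin sl; first by read eR; rewrite eval_add addn0 // -/N; lia.
  by step_jmp; apply: (IH _ _ lo mid) => //; try lia; do !apply: env_upd => //.
have xout : x \notin trie h reps by apply/negP => /inE[].
step_bin mid; first by read eR; rewrite eval_add addn0 // -/N; clear -midE vlh mh_lt hN2; lia.
by step_jmp; apply: (IH _ _ mid hi) => //; try lia; [do !apply: env_upd => // | right].
Qed.

Lemma halts_header e R t : env R -> R 4 = 0 -> h.+1 <= 2 ^ e ->
  t + 42 * e + 45 <= bound -> halts 22 R 0 t.
Proof.
move=> eR R4 he tb.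
step_jz (size reps); first exact: (e21 eR).
have [reps_nil|reps0] := posnP (size reps).
  rewrite /=; apply: (@halts_bucket e) => //; try lia.
  by rewrite R4; case: (reps) reps_nil.
rewrite /=.
step_const 0; first by rewrite /wmod mod0n.
have hN1 : h.+1 < N by lia.
step_bin h.+1; first by read eR; rewrite eval_add ?addn1.
have eR' : env (upd (upd R 5 0) 6 h.+1) by apply: env_upd => //; apply: env_upd.
apply: (halts_trie_loop (e' := e) eR' (erefl _) (erefl _) reps0 _ he (or_introl erefl)).
- by rewrite /= leqnn.
- by rewrite ltnn.
- exact: ltnW.
- by clear -tb; lia.
Qed.

Lemma halts_start e p : nth 0 M c = p -> p + 8 <= N ->
    segment M p [:: mode; size reps; h; m; rec; a1; D1; base1] ->
    h.+1 <= 2 ^ e -> 42 * e + 80 <= bound ->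
  halts 0 (upd (upd (fun=> 0) 0 c) 1 j) 0 0.
Proof.
move=> Mc pN seg he tb.
have modM i : wmod w (nth 0 M i) = nth 0 M i by rewrite /wmod modn_small.
have segE i v : i < 8 -> nth 0 [:: mode; size reps; h; m; rec; a1; D1; base1] i = v ->
    wmod w (nth 0 M (p + i)) = v by move=> lti <-; rewrite modM seg.
have incr i : i < 7 -> eval_binop w OAdd (p + i) 1 = p + i.+1.
  by move=> lti; rewrite eval_add ?addn1 ?addnS // -/N; clear -pN lti; lia.
have const v : v <= 3 -> wmod w v = v by move=> lev; rewrite /wmod modn_small // (leq_ltn_trans lev).
step_const (2 ^ k0); first by rewrite /wmod modn_small.
step_jz (2 ^ k0); first by [].
rewrite ifF; last by apply/negbTE; rewrite expn_eq0.
step_const 1; first exact: const.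
step_const 2; first exact: const.
step_const 3; first exact: const.
step_load (p + 0); first by rewrite addn0 -Mc; exact: modM.
step_load mode; first exact: (segE 0).
step_bin (p + 1); first exact: (incr 0).
step_load (size reps); first exact: (segE 1).
step_bin (p + 2); first exact: (incr 1).
step_load h; first exact: (segE 2).
step_bin (p + 3); first exact: (incr 2).
step_load m; first exact: (segE 3).
step_bin (p + 4); first exact: (incr 3).
step_load rec; first exact: (segE 4).
step_bin (p + 5); first exact: (incr 4).
step_load a1; first exact: (segE 5).
step_bin (p + 6); first exact: (incr 5).
step_load D1; first exact: (segE 6).
step_bin (p + 7); first exact: (incr 6).
step_load base1; first exact: (segE 7).
step_const 0; first exact: const.
set R := upd _ 4 0.
have eR : env R by split.
have R4 : R 4 = 0 by [].
apply: (halts_header (e := e)) => //.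
by rewrite /=; clear -tb; lia.
Qed.

End Main.

Lemma structure_halts (k0 kk w : nat) (M : seq nat) (oracle : nat -> nat -> nat) (out bound : nat)
    (c j mode h p e : nat) (ks : seq nat) (A B : nat -> nat) :
    1 < k0 -> kk <= k0 -> k0 < w -> 0 < h <= w -> 0 < size ks -> size ks + h < 2 ^ w ->
    j < 2 ^ h -> all (fun k => k < 2 ^ h) ks -> nth 0 ks 0 <= j ->
    (forall i, A i < 2 ^ w /\ B i < 2 ^ w) ->
    (forall i, is_pred ks i j ->
       answer mode (2 ^ w) kk (oracle c) j (nth 0 ks i) (A i) (B i) = out) ->
    out < 2 ^ w -> (forall i, nth 0 M i < 2 ^ w) -> nth 0 M c = p ->
    structure_ok w M p mode h ks A B -> h.+1 <= 2 ^ e -> 42 * e + 80 <= bound ->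
  halts (query_program k0 kk) w M oracle out bound 0 (upd (upd (fun=> 0) 0 c) 1 j) 0 0.
Proof.
move=> k01 kkk k0w /andP[h0 hw] ks0 mh jh ksh key0 ABN outE outN MN Mc.
case=> rec [a1 [D1 [base1 [pN seg rec_ok dict]]]] he tb.
have hN : 2 ^ h <= 2 ^ w by rewrite leq_exp2l.
have ksN : all (fun k => k < 2 ^ w) ks by apply/allP=> k /(allP ksh)/leq_trans->.
have repsh : all (fun r => r < 2 ^ h) (rep_keys h ks).
  apply/allP=> _ /mapP[i _ ->]; case: (ltnP (i * h) (size ks)) => lt.
    exact: (allP ksh _ (mem_nth _ lt)).
  by rewrite nth_default // expn_gt0.
exact: (@halts_start k0 kk w M oracle out bound c j mode h rec a1 D1 base1 ks A B _ _ _ _ _ _ _ _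
         _ _ _ _ _ _ _ _ _ e p).
Qed.

(** * Memory images *)

Section ShortWords.
Variables (k0 kk w : nat) (M : seq nat) (oracle : nat -> nat -> nat) (out bound : nat).
Let N := 2 ^ w.
Notation halts := (halts (query_program k0 kk) w M oracle out bound).
Hypotheses (w_gt0 : 0 < w) (w_le : w <= k0) (M_lt : forall i, nth 0 M i < N).

(** The loop has no end-of-text test: [j <= count_mem l V] makes it stop inside [V]. *)
Lemma halts_scan (l : nat) (V : seq nat) i j R t :
    R 1 = j -> R 4 = l -> R 6 = i -> R 10 = 1 ->
    (forall k, k < size V -> nth 0 M (i + k) = nth 0 V k) ->
    i + size V < N -> 0 < j <= count_mem l V -> out = i + select_ V l j ->
    t + 6 * size V < bound -> halts 105 R 0 t.
Proof.
elim: V i j R t => [|x V IH] i j R t R1 R4 R6 R10 MV ltN vj outE tb; first by move: vj => /=; lia.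
have Mx := MV 0 isT; rewrite addn0 /= in Mx.
have jV : j <= size (x :: V) by case/andP: vj => _ /leq_trans->; rewrite ?count_size.
rewrite /= in ltN jV tb vj.
have xl : (x == l) <= j by case: eqP vj => //= _; lia.
step_load x; first by rewrite R6 Mx /wmod modn_small // -Mx.
step_bin (nat_of_bool (x == l)); first by rewrite /upd /= R4 eval_eq.
step_bin i.+1; first by rewrite /upd /= R6 R10 eval_add ?addn1 // -/N; lia.
step_bin (j - (x == l)); first by rewrite /upd /= R1 eval_sub // -/N; lia.
step_jz (j - (x == l)); first by [].
have [j0|j0] := posnP (j - (x == l)).
  rewrite /=; apply: halts_halt; [reflexivity | | by [] | by lia].
  rewrite /upd /= outE.
  have xeq : x = l by apply/eqP; move: vj j0; case: (x == l); lia.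
  have -> : j = 1 by move: j0; rewrite xeq eqxx; lia.
  by have := select_mid [::] V l; rewrite xeq /= => ->; rewrite addn1.
rewrite /=; step_jmp; apply: (IH i.+1 (j - (x == l))) => //.
- by move=> k ltk; rewrite addSnnS MV.
- by lia.
- by rewrite j0 /=; lia.
- rewrite outE addSnnS; congr (_ + _).
  have vr : 0 < j - (x == l) <= count_mem l V by rewrite j0 /=; lia.
  have := select_catr [:: x] vr; rewrite /= addn0 subnKC // => ->.
by lia.
Qed.

Lemma halts_short c j l (V : seq nat) :
    (if c < N then l = c else nth 0 M c = l) ->
    (forall k, k < size V -> nth 0 M k = nth 0 V k) ->
    size V < N -> 0 < j <= count_mem l V -> out = select_ V l j ->
    6 * size V + 8 < bound ->
  halts 0 (upd (upd (fun=> 0) 0 c) 1 j) 0 0.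
Proof.
move=> lc MV ltN vj outE tb.
have N1 : 1 < N by apply: leq_trans (ltn_expl w (isT : 1 < 2)).
(* Since [w <= k0], the constant [2 ^ k0] wraps to 0; this is how one fixed program recognises short
   words. *)
step_const 0; first by apply/eqP; apply: dvdn_exp2l.
step_jz 0; first by [].
rewrite /=; step_const 1; first by rewrite /wmod modn_small.
(* Register 0 starts with the unreduced code; adding zero reduces it, so comparing the two detects
   codes that are not words. *)
step_bin (c %% N); first by rewrite /upd /= /eval_binop addn0.
step_bin (nat_of_bool (c %% N == c)); first by rewrite /upd /= eval_eq.
step_jz (nat_of_bool (c %% N == c)); first by [].
case: (ltnP c N) lc => lc lE.
  rewrite (modn_small lc) eqxx /=; step_jmp.
  by apply: (@halts_scan l V 0 j) => //; lia.
have -> : (c %% N == c) = false.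
  by apply/negbTE; rewrite neq_ltn (leq_trans _ lc) // ltn_mod ltnW.
rewrite /=; step_load l; first by rewrite /upd /= lE /wmod modn_small // -lE.
by apply: (@halts_scan l V 0 j) => //; lia.
Qed.

End ShortWords.

Lemma count_map_in (T : eqType) (f : T -> nat) (a : T) (S : seq T) :
  {in S, forall x, f x = f a -> x = a} -> count_mem (f a) (map f S) = count_mem a S.
Proof.
move=> inj; rewrite count_map; apply: eq_in_count => x xS /=.
by apply/eqP/eqP => [|->]; first exact: inj.
Qed.

Lemma select_map_in (T : eqType) (f : T -> nat) (a : T) (S : seq T) j :
  {in S, forall x, f x = f a -> x = a} -> select_ (map f S) (f a) j = select_ S a j.
Proof.
move=> inj; rewrite /select_ count_map_in // size_map; case: ifP => // _.
apply: eq_find => i; rewrite /rank_ -map_take count_map_in // => x /mem_take; exact: inj.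
Qed.

(* A character of code at least [N] gets the code of some character that does not occur in [S]. *)
Lemma exists_labels (T : finType) (S : seq T) N : size S < N ->
  exists f : T -> nat, [/\ forall x, f x < N, forall x, code x < N -> f x = code x
                         & {in S &, injective f}].
Proof.
move=> ltS.
pose big := undup [seq x <- S | N <= code x].
pose small := undup [seq code x | x <- S & code x < N].
pose free := [seq y <- iota 0 N | y \notin small].
have szbig : size big + size small <= size S.
  apply: leq_trans (leq_add (size_undup _) (size_undup _)) _.
  rewrite size_map !size_filter -(count_predC (fun x => N <= code x) S) leq_add2l.
  by apply: sub_count => x /=; rewrite ltnNge.
have szfree : N <= size free + size small.
  rewrite -[N in N <= _](size_iota 0) -(count_predC (mem small) (iota 0 N)) addnC.
  rewrite /free size_filter leq_add2l -size_filter; apply: uniq_leq_size.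
    by rewrite filter_uniq ?iota_uniq.
  by move=> y; rewrite mem_filter => /andP[].
have ltfree y : y \in free -> y < N by rewrite mem_filter mem_iota => /andP[_ /andP[]].
have ufree : uniq free by rewrite filter_uniq ?iota_uniq.
pose f x := if code x < N then code x else nth 0 free (index x big).
have fE x : x \in S -> N <= code x -> index x big < size free.
  move=> xS lx; have : index x big < size big by rewrite index_mem mem_undup mem_filter lx.
  by lia.
exists f; split.
- move=> x; rewrite /f; case: ifP => // _.
  case: (ltnP (index x big) (size free)) => lt; first exact/ltfree/mem_nth.
  by rewrite nth_default //; lia.
- by move=> x lx; rewrite /f lx.
have fsep x y : x \in S -> y \in S -> code x < N -> N <= code y -> f x <> f y.
  move=> xS yS lx ly; rewrite /f lx ltnNge ly /= => eqf.
  have : nth 0 free (index y big) \in free by rewrite mem_nth ?fE.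
  rewrite mem_filter -eqf mem_undup => /andP[/negP[]].
  by apply: map_f; rewrite mem_filter lx.
move=> x y xS yS eqf.
case: (ltnP (code x) N) => lx; case: (ltnP (code y) N) => ly.
- by move: eqf; rewrite /f lx ly => /ord_inj/enum_rank_inj.
- by case: (fsep x y).
- by case: (fsep y x).
move: eqf; rewrite /f !ltnNge lx ly /= => /eqP.
rewrite nth_uniq ?fE // => /eqP eqi.
have xb : x \in big by rewrite mem_undup mem_filter lx.
have yb : y \in big by rewrite mem_undup mem_filter ly.
by rewrite -(nth_index x xb) eqi nth_index.
Qed.

Lemma nth_code (T : finType) (f : T -> nat) (a : T) :
  nth 0 [seq f x | x <- enum T] (code a) = f a.
Proof. by rewrite (nth_map a) ?nth_enum_rank // -cardE /code. Qed.

Lemma select_oracleE (T : finType) (S : seq T) (a : T) j :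
  select_oracle S (code a) j = select_ S a j.
Proof. by rewrite /select_oracle /code valK enum_rankK. Qed.

Lemma short_memory (T : finType) (k0 kk w : nat) (S1 S2 : seq T) : w <= k0 -> size S2 < 2 ^ w ->
  exists M : seq nat, [/\ size M <= 2 ^ k0 + #|T|, all (fun x => x < 2 ^ w) M &
    forall a j, 0 < j <= count_mem a S2 -> forall bound, 6 * 2 ^ k0 + 9 <= bound ->
      halts (query_program k0 kk) w M (select_oracle S1) (select_ S2 a j) bound 0
        (upd (upd (fun=> 0) 0 (code a)) 1 j) 0 0].
Proof.
move=> wk ltS; set N := 2 ^ w in ltS *.
have [f [flt fcode finj]] := exists_labels ltS.
(* Computed addresses reach only the first [N] cells, which hold the text. The labels beyond them
   are reached through the unreduced code in register 0. *)
pose ent i := if i < N then nth 0 (map f S2) i else nth 0 (map f (enum T)) i.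
have N0 : 0 < N by rewrite expn_gt0.
have Nk0 : N <= 2 ^ k0 by rewrite leq_exp2l.
have nthf s i : nth 0 (map f s) i < N.
  case: (ltnP i (size (map f s))) => lt; last by rewrite nth_default.
  by have /mapP[x _ ->] := mem_nth 0 lt.
have entlt i : ent i < N by rewrite /ent; case: ifP.
have entE i : i < N + #|T| -> nth 0 (mkseq ent (N + #|T|)) i = ent i.
  by move=> lti; rewrite nth_mkseq.
exists (mkseq ent (N + #|T|)); split.
- by rewrite size_mkseq leq_add2r.
- by apply/allP=> _ /mapP[i _ ->].
move=> a j vj bound tb.
have aS : a \in S2 by rewrite -has_pred1 has_count; lia.
have w0 : 0 < w.
  have : 0 < size S2 by case: (S2) aS.
  by case: w @N {ent nthf entlt entE fcode flt N0 Nk0 wk} ltS => //; rewrite expn0; lia.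
have inj : {in S2, forall x, f x = f a -> x = a} by move=> x xS; apply: finj.
have ltc : code a < #|T| by exact: ltn_ord.
apply: (@halts_short k0 kk w _ _ _ _ w0 wk _ _ _ (f a) (map f S2)).
- move=> i; case: (ltnP i (N + #|T|)) => lt; first by rewrite entE.
  by rewrite nth_default ?size_mkseq.
- case: ifP => lc; first exact: fcode.
  by rewrite entE /ent ?lc ?nth_code // ltn_addl.
- rewrite size_map => k ltk; rewrite entE /ent ?(ltn_trans ltk) //.
  by rewrite ltn_addr // (ltn_trans ltk).
- by rewrite size_map.
- by rewrite count_map_in.
- by rewrite select_map_in.
by rewrite size_map; lia.
Qed.

Lemma allocate (T : finType) (w kk mode h mm base : nat) (S1 S2 : seq T) (s : seq T) :
    0 < h <= w -> mode < 2 ^ w -> size S2 < 2 ^ h ->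
    (forall a, exists ks A B, size ks <= mm /\ pieces mode (2 ^ w) kk S1 a S2 ks A B) ->
    base + size s * (150 * mm) <= 2 ^ w ->
  exists (ptr : T -> nat) L, [/\ size L <= size s * (150 * mm), all (fun x => x < 2 ^ w) L,
    forall a, ptr a < 2 ^ w &
    forall M, segment M base L -> forall a, a \in s -> exists ks A B,
      [/\ size ks <= mm, pieces mode (2 ^ w) kk S1 a S2 ks A B &
          structure_ok w M (ptr a) mode h ks A B]].
Proof.
move=> vh modeN ltS2 pcs; set N := 2 ^ w in modeN pcs *.
have N0 : 0 < N by rewrite expn_gt0.
elim: s => [|a s IH] leN; first by exists (fun=> 0), [::].
have [|ptr [L [szL ltL ltp LP]]] := IH; first by apply: leq_trans leN; rewrite /=; lia.
have [ks [A [B [szks pc]]]] := pcs a; have [key0 ks0 ksle ABlt _] := pc.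
have ksh : all (fun k => k < 2 ^ h) ks.
  by apply/allP=> k /(allP ksle) lek; apply: leq_ltn_trans ltS2.
rewrite /= mulSn in leN.
have [|L' [szL' ltL' L'P]] := exists_structure (base := base + size L) vh modeN ks0 ksh ABlt.
  by rewrite -/N; lia.
exists (fun x => if x == a then base + size L else ptr x), (L ++ L'); split.
- by rewrite size_cat /=; lia.
- by rewrite all_cat ltL.
- by move=> x; case: eqP => // _; lia.
move=> M /segment_cat[segL segL'] x; rewrite inE; case: (x =P a) => [-> _|_ /= xs].
  by exists ks, A, B; split=> //; exact: L'P.
exact: LP.
Qed.

Lemma double_leq_exp w : 2 * w <= 2 ^ w.
Proof. by case: w => // w; rewrite expnS leq_mul2l /=; exact: ltn_expl. Qed.

Lemma long_memory (T : finType) (k0 kk w mode mm : nat) (S1 S2 : seq T) :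
    1 < k0 -> kk <= k0 -> k0 < w -> mode < 2 ^ w -> size S1 + size S2 < 2 ^ w ->
    (forall a, exists ks A B, size ks <= mm /\ pieces mode (2 ^ w) kk S1 a S2 ks A B) ->
    #|T| * (150 * mm).+1 <= 2 ^ w ->
  exists M : seq nat, [/\ size M <= #|T| * (150 * mm).+1, all (fun x => x < 2 ^ w) M &
    forall a j, 0 < j <= count_mem a S2 -> forall bound,
      164 * (trunc_log 2 (trunc_log 2 (size S1 + size S2))).+1 <= bound ->
      halts (query_program k0 kk) w M (select_oracle S1) (select_ S2 a j) bound 0
        (upd (upd (fun=> 0) 0 (code a)) 1 j) 0 0].
Proof.
move=> k01 kkk k0w modeN ltn pcs leN; set n := size S1 + size S2 in ltn *.
(* The key length [h] comes from [n] and not from [w], so both binary searches take time logarithmic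
   in [log n]. *)
set l := trunc_log 2 n; pose h := l.+1.
have ltnh : n < 2 ^ h by exact: trunc_log_ltn.
have hw : 0 < h <= w.
  case: (posnP n) => [n0|n0]; first by rewrite /h /l n0 trunc_log0; lia.
  by rewrite /= -(ltn_exp2l l w (isT : 1 < 2)); apply: leq_ltn_trans ltn; rewrite trunc_logP.
have ltS2 : size S2 < 2 ^ h by lia.
have szE : size (enum T) = #|T| by rewrite -cardE.
have leN' : #|T| + size (enum T) * (150 * mm) <= 2 ^ w by rewrite szE; lia.
have [ptr [L [szL ltL ltp LP]]] := allocate hw modeN ltS2 pcs leN'.
exists (map ptr (enum T) ++ L); split.
- by rewrite size_cat size_map szE; rewrite szE in szL; lia.
- by rewrite all_cat ltL andbT; apply/allP=> _ /mapP[x _ ->].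
move=> a j vj bound tb; set M := _ ++ L.
have [segP segL] : segment M 0 (map ptr (enum T)) /\ segment M #|T| L.
  by have := (segment_cat M 0 (map ptr (enum T)) L).1; rewrite size_map szE; apply.
have [ks [A [B [szks [key0 ks0 ksle ABlt ans] ok]]]] := LP M segL a (mem_enum T a).
have Mlt i : nth 0 M i < 2 ^ w.
  case: (ltnP i (size M)) => lt; last by rewrite nth_default // expn_gt0.
  suff : all (fun x => x < 2 ^ w) M by move/allP/(_ _ (mem_nth 0 lt)).
  by rewrite all_cat ltL andbT; apply/allP=> _ /mapP[x _ ->].
have Mc : nth 0 M (code a) = ptr a.
  rewrite -(nth_code ptr a) -segP ?add0n // size_map szE; exact: ltn_ord.
have /andP[_ sb] := select_bounds vj.
have T0 : 0 < #|T| by apply/card_gt0P; exists a.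
have lejS : j <= size S2 by case/andP: vj => _ /leq_trans->; rewrite ?count_size.
(* With this [e], [42 * e + 80] is [42 * trunc_log 2 l + 164], hence the constant 164. *)
pose e := (trunc_log 2 l).+2.
have he : h.+1 <= 2 ^ e.
  have := @trunc_log_ltn 2 l isT; have : 0 < 2 ^ (trunc_log 2 l) by rewrite expn_gt0.
  by rewrite /h /e !expnS; lia.
apply: (@structure_halts k0 kk w M (select_oracle S1) _ _ (code a) j mode h (ptr a) e ks A B) => //.
- have mmN : 150 * mm < 2 ^ w.
    by apply: leq_trans leN; move: T0; case: #|T| => // t _; rewrite mulSn; lia.
  by have := double_leq_exp w; lia.
- by lia.
- by apply/allP=> k /(allP ksle) lek; apply: leq_ltn_trans ltS2.
- by rewrite key0.
- move=> i pi; rewrite -(ans i j vj pi) /answer.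
  by rewrite select_oracleE.
- by apply: leq_ltn_trans sb _; apply: leq_ltn_trans ltn; exact: leq_addl.
by rewrite /e; lia.
Qed.

Theorem theorem1 :
  forall (T : finType),                       (* constant-size alphabet *)
  exists (C : nat) (P : program),             (* constants and the (fixed) query program *)
  forall (S1 S2 : seq T) (d w : nat),
    edit_distance S1 S2 d ->
    size S1 + size S2 < 2 ^ w ->              (* words of at least log(|S1|+|S2|) bits *)
    exists M : seq nat,                       (* the additional stored words *)
      size M <= C * d.+1 /\
      all (fun x => x < 2 ^ w) M /\
      forall (a : T) (j : nat), 0 < j <= count_mem a S2 ->
        exists ns nt,
          runs P w M (select_oracle S1) (code a) j (select_ S2 a j) ns nt /\
          ns <= 1 /\
          nt <= C * (trunc_log 2 (trunc_log 2 (size S1 + size S2))).+1.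
Proof.
(* Offsets in a block of [g] positions are given [g] bits each, so [g * g] bits hold a packed
   block. *)
move=> T; pose g := 300 * #|T|.+1; pose k0 := g * g.
(* The first term pays for the scan, the second for [#|T| * (600 * d + 151)] words, and 200 covers
   the factor 164. *)
pose C := 6 * 2 ^ k0 + 751 * #|T| + 200.
exists C, (query_program k0 g) => S1 S2 d w [ed _] ltn.
have gE : g = 300 * #|T|.+1 by [].
have g0 : 0 < g by [].
have CE : C = 6 * 2 ^ k0 + 751 * #|T| + 200 by [].
clearbody C.
have [wk|kw] := leqP w k0.
  have ltS2 : size S2 < 2 ^ w by lia.
  have [M [szM ltM MP]] := short_memory g S1 wk ltS2.
  exists M; split; first by apply: leq_trans szM _; rewrite mulnS; lia.
  split=> // a j vj; apply: MP => //.
  by rewrite mulnS; lia.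
have gk : g <= k0 by rewrite /k0 leq_pmulr.
have k01 : 1 < k0 by lia.
have wrap mode mm : mode < 2 ^ w -> #|T| * (150 * mm).+1 <= 2 ^ w ->
    #|T| * (150 * mm).+1 <= C * d.+1 ->
    (forall a, exists ks A B, size ks <= mm /\ pieces mode (2 ^ w) g S1 a S2 ks A B) ->
  exists M : seq nat, size M <= C * d.+1 /\ all (fun x => x < 2 ^ w) M /\
      forall (a : T) (j : nat), 0 < j <= count_mem a S2 -> exists ns nt,
          runs (query_program k0 g) w M (select_oracle S1) (code a) j (select_ S2 a j) ns nt /\
          ns <= 1 /\ nt <= C * (trunc_log 2 (trunc_log 2 (size S1 + size S2))).+1.
  move=> modeN leN leC pcs.
  have [M [szM ltM MP]] := long_memory k01 gk kw modeN ltn pcs leN.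
  exists M; split; first exact: leq_trans leC.
  split=> // a j vj; apply: MP => //.
  by rewrite leq_mul2r; apply/orP; right; lia.
have N1 : 1 < 2 ^ w by apply: leq_trans (ltn_expl w (isT : 1 < 2)); lia.
have leC0 : #|T| * (150 * (4 * d + 1)).+1 <= C * d.+1.
  apply: (@leq_trans (751 * #|T| * d.+1)); last by rewrite leq_mul2r CE; lia.
  by rewrite -mulnA mulnCA leq_mul2l; lia.
case: (leqP (#|T| * (150 * (4 * d + 1)).+1) (2 ^ w)) => big.
  apply: (wrap 0 (4 * d + 1)) => // [|a]; first exact: ltnW.
  by apply: edits_pieces ed; apply: leq_ltn_trans ltn; rewrite ?leq_addr ?leq_addl.
(* The choice of [g] keeps [150 * #|T| * q] within half of [2 ^ w]; the other [301 * #|T|] words fit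
   in the second half because [602 * #|T| <= k0]. *)
have leB : #|T| * (150 * (size S2 %/ g + 2)).+1 <= 2 ^ w.
  have q1 : size S2 %/ g * g <= size S2 by exact: leq_trunc_div.
  have k0N : 2 ^ k0 < 2 ^ w by rewrite ltn_exp2l.
  have ltk0 := ltn_expl k0 (isT : 1 < 2).
  have le602 : 602 * #|T| <= k0 by rewrite /k0 gE; clear; move: #|T| => t; nia.
  move: q1; set q := size S2 %/ g; rewrite gE => q1.
  have le300 : 300 * (#|T| * q) <= size S2.
    by apply: leq_trans q1; clear; move: #|T| => t; nia.
  have -> : #|T| * (150 * (q + 2)).+1 = 150 * (#|T| * q) + 301 * #|T|.
    by clear; move: #|T| => t; nia.
  by clear -ltk0 le602 k0N le300 ltn; lia.
(* By [big] and [leC0], [2 ^ w < C * d.+1], so fitting in the addressable words gives the space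
   bound. *)
apply: (wrap 1 (size S2 %/ g + 2)) => // [|a]; first by apply: leq_trans leB _; lia.
apply: block_pieces; last by apply: leq_ltn_trans ltn; exact: leq_addl.
  by rewrite g0 /= ltnW // ltn_expl.
by rewrite leq_exp2l // -/k0 ltnW.
Qed.
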